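(* There are no counterexamples of type (a) in the class of quasi-constructible and contractible $2$-complexes. That is, if $L$ is a finite simplicial complex of dimension $2$ which is contractible and quasi-constructible, and $\sigma$ is a $2$-simplex of $L$, then the subcomplex $K=L-\sigma$, obtained from $L$ by removing the (open) simplex $\sigma$, is aspherical.
   Context: A path connected space $X$ is aspherical if $\pi_n(X)$ is trivial for all $n\ge 2$. A counterexample of type (a) to Whitehead's asphericity question (is every subcomplex of an aspherical $2$-dimensional complex itself aspherical?) is a pair $K\subset L$ where $L$ is a finite contractible $2$-complex, $K=L-e$ for some $2$-cell $e$ of $L$, and $K$ is non-aspherical. Finite $T_0$-spaces are identified with finite posets: $x\le y$ iff $x$ belongs to every open set containing $y$; the sets $U_x=\{y: y\le x\}$ form a basis of the topology, and contractibility refers to this topology. The height of a finite space is the maximum length of its chains, where $x_0<\cdots<x_n$ has length $n$. For a finite simplicial complex $K$, the face poset $\mathcal{X}(K)$ is the poset of (nonempty) simplices of $K$ ordered by inclusion, regarded as a finite $T_0$-space. qc-reduction: let $X$ be a finite $T_0$-space of height $2$ and let $a,b\in X$ be two (distinct) maximal points such that $U_a\cup U_b$ is contractible. Let $Y=X\cup\{c\}$, where $c$ is a new point with $a,b<c$ (so the elements strictly below $c$ are exactly those of $U_a\cup U_b$). Then there is a qc-reduction from $X$ to $Y\smallsetminus\{a,b\}$. A finite space of height $2$ is qc-reducible if one can obtain from it a space with a maximum by performing a (finite) sequence of qc-reductions. A finite $2$-dimensional simplicial complex $K$ is contractible and quasi-constructible if and only if its face poset $\mathcal{X}(K)$ is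 qc-reducible; this characterization is used here as the meaning of ''contractible and quasi-constructible''. *)

(* Defs.v *)
From HB Require Import structures.
From Stdlib Require Import Relation_Operators.
From mathcomp Require Import all_boot all_order all_algebra.
From mathcomp Require Import all_classical all_reals all_analysis.

Set Implicit Arguments.
Unset Strict Implicit.
Unset Printing Implicit Defensive.

Import Order.TTheory GRing.Theory Num.Theory.
Import numFieldNormedType.Exports.

Local Open Scope classical_set_scope.
Local Open Scope ring_scope.

Section Homotopy.
Variable R : realType.

(* Maps out of [0, 1], out of a cube, or out of a product with [0, 1] are
   total functions of which only the restriction to that set matters:
   continuity is required there, for the subspace topology. *)

Definition contractible (T : topologicalType) : Prop :=
  exists (x0 : T) (H : T * R -> T),
    [/\ {within [set p | 0 <= p.2 <= 1], continuous H},
        forall x, H (x, 0) = x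
      & forall x, H (x, 1) = x0].

Definition path_connected (T : topologicalType) : Prop :=
  [set: T] !=set0 /\
  forall x y : T, exists gamma : R -> T,
    [/\ {within [set t | 0 <= t <= 1], continuous gamma},
        gamma 0 = x & gamma 1 = y].

Definition cube (n : nat) : set 'rV[R]_n := [set u | forall i, 0 <= u 0 i <= 1].

Definition cube_boundary (n : nat) : set 'rV[R]_n :=
  [set u | cube u /\ exists i, u 0 i = 0 \/ u 0 i = 1].

Definition nloop (n : nat) (T : topologicalType) (x0 : T) (f : 'rV[R]_n -> T) :
    Prop :=
  {within @cube n, continuous f} /\ forall u, cube_boundary u -> f u = x0.

Definition nloop_homotopic (n : nat) (T : topologicalType) (x0 : T)
    (f g : 'rV[R]_n -> T) : Prop :=
  exists H : 'rV[R]_n * R -> T,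
    [/\ {within [set p | cube p.1 /\ 0 <= p.2 <= 1], continuous H},
        forall u, cube u -> H (u, 0) = f u,
        forall u, cube u -> H (u, 1) = g u
      & forall u t, cube_boundary u -> 0 <= t <= 1 -> H (u, t) = x0].

(* The elements of pi_n(T, x0) are the homotopy classes, relative to the
   boundary, of the n-loops at x0; its identity is the class of the constant
   loop. *)
Definition trivial_pi (n : nat) (T : topologicalType) (x0 : T) : Prop :=
  forall f : 'rV[R]_n -> T, nloop x0 f -> nloop_homotopic x0 f (cst x0).

Definition aspherical (T : topologicalType) : Prop :=
  path_connected T /\ forall (n : nat) (x0 : T), (2 <= n)%N -> trivial_pi n x0.

End Homotopy.

Section FiniteSpace.
Context {d : Order.disp_t}.

(* The topology of a poset: the open sets are the down-sets. *)
Definition poset_space (X : porderType d) : Type := X.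

Section Topology.
Variable X : porderType d.

HB.instance Definition _ := Choice.on (poset_space X).

Definition down_closed : set_system (poset_space X) :=
  [set D | forall x y : X, (x <= y)%O -> D y -> D x].

Let down_closedT : down_closed setT. Proof. by []. Qed.

Let down_closedI : setI_closed down_closed.
Proof. by move=> A B hA hB x y xy [/(hA _ _ xy) Ax /(hB _ _ xy)]. Qed.

Let down_closed_bigU (I : Type) (f : I -> set (poset_space X)) :
  (forall i, down_closed (f i)) -> down_closed (\bigcup_i f i).
Proof. by move=> hf x y xy [i _ /(hf i _ _ xy) fx]; exists i. Qed.

HB.instance Definition _ := isOpenTopological.Build (poset_space X)
  down_closedT down_closedI down_closed_bigU.

End Topology.

Definition minimal_open (X : porderType d) (x : X) : set (poset_space X) :=
  [set y : X | (y <= x)%O].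

Variable X : finPOrderType d.

Definition chain (C : {set X}) : bool :=
  [forall x in C, forall y in C, (x >=< y)%O].

(* A chain with n + 1 elements has length n. *)
Definition height : nat := (\max_(C : {set X} | chain C) #|C|.-1)%N.

Definition maximal_point (a : X) : Prop := forall x : X, (a <= x)%O -> x = a.

Definition has_maximum : Prop := exists m : X, forall x : X, (x <= m)%O.

End FiniteSpace.

Arguments height {d} X.
Arguments has_maximum {d} X.

(* The poset obtained from X by adding a point c (here None) whose strict lower
   bounds are the points of U_a and U_b, and then deleting a and b. *)
Section QcMerge.
Context {d : Order.disp_t} (X : finPOrderType d) (a b : X).

Definition qc_merge : Type := option {x : X | (x != a) && (x != b)}.

HB.instance Definition _ := Finite.on qc_merge.

Definition qc_merge_le : rel qc_merge := fun u v =>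
  match u, v with
  | Some x, Some y => (val x <= val y)%O
  | Some x, None => (val x <= a)%O || (val x <= b)%O
  | None, Some _ => false
  | None, None => true
  end.

Let qc_merge_le_refl : reflexive qc_merge_le.
Proof. by case=> [x|] //=; apply: lexx. Qed.

Let qc_merge_le_anti : antisymmetric qc_merge_le.
Proof.
case=> [x|] [y|] //=; last by rewrite andbF.
by move/le_anti/val_inj=> ->.
Qed.

Let qc_merge_le_trans : transitive qc_merge_le.
Proof.
case=> [y|] [x|] [z|] //=; first exact: le_trans.
by move=> xy /orP[] /(le_trans xy) ->; rewrite ?orbT.
Qed.

HB.instance Definition _ := Order.Le_isPOrder.Build d qc_merge
  qc_merge_le_refl qc_merge_le_anti qc_merge_le_trans.

End QcMerge.

Section QcReduction.
Variables (R : realType) (d : Order.disp_t).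

Variant qc_reduction (X : finPOrderType d) : finPOrderType d -> Prop :=
  QcReduction (a b : X) of
      height X = 2%N & a != b & maximal_point a & maximal_point b &
      contractible R (set_type (minimal_open a `|` minimal_open b)) :
    qc_reduction X (qc_merge a b).

Definition qc_reducible (X : finPOrderType d) : Prop :=
  height X = 2%N /\
  exists Y, clos_refl_trans_1n _ qc_reduction X Y /\ has_maximum Y.

End QcReduction.

Section FacePoset.
Variables (V : finType) (L : {set {set V}}).

Definition face_poset : Type := {s : {set V} | s \in L}.

HB.instance Definition _ := Finite.on face_poset.

Definition face_le : rel face_poset := fun s t => val s \subset val t.

Let face_le_refl : reflexive face_le.
Proof. by move=> s; apply: subxx. Qed.

Let face_le_anti : antisymmetric face_le.
Proof. by move=> s t; rewrite /face_le -finset.eqEsubset => /eqP/val_inj. Qed.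

Let face_le_trans : transitive face_le.
Proof. by move=> t s u; apply: fintype.subset_trans. Qed.

HB.instance Definition _ := Order.Le_isPOrder.Build
  Order.SetSubsetOrder.subset_display face_poset
  face_le_refl face_le_anti face_le_trans.

End FacePoset.

Section SimplicialComplex.
Variable V : finType.
Implicit Type L : {set {set V}}.

(* Elements of V that are not vertices of L are allowed. *)
Definition simplicial_complex L : Prop :=
  finset.set0 \notin L /\
  forall s t : {set V}, s \in L -> t \subset s -> t != finset.set0 -> t \in L.

Definition dimension L : nat := (\max_(s : {set V} | s \in L) #|s|.-1)%N.

(* Barycentric coordinates, with the product topology on R^V. *)
Definition polyhedron (R : realType) L : set {ptws V -> R} :=
  [set x | [/\ forall v, 0 <= x v, \sum_v x v = 1
             & [set v | x v != 0]%SET \in L]].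

Definition realization (R : realType) L : topologicalType :=
  set_type (@polyhedron R L).

(* A finite 2-complex is contractible and quasi-constructible if and only if its
   face poset is qc-reducible; this characterization serves as the definition. *)
Definition contractible_quasi_constructible (R : realType) L : Prop :=
  qc_reducible R (face_poset L).

End SimplicialComplex.

(* Main.v *)
From Stdlib Require Import Relation_Operators.
Require Import Defs.
From mathcomp Require Import all_boot all_order all_algebra.
From mathcomp Require Import all_classical all_reals all_analysis.
From mathcomp Require Import ring lra.

(**
Removing a triangle from L leaves a space homotopy equivalent to a circle, and
a circle is aspherical.

Along a sequence of qc-reductions starting at the face poset of L, every point
y of the current poset stands for a subcomplex A y of L: a simplex carries the
complex of its faces, and the point replacing a and b carries A a :|: A b.
Two such subcomplexes always meet in the union of the A z for z below both
indices. The hypothesis on a reduction is that U_a and U_b have a contractible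
union; it forces the intersection of U_a and U_b, a poset of height at most 1,
to be a tree, in the sense that it can be reduced to a point by removing beat
points. Hence A a and A b are glued along a tree of subcomplexes.

The gluing is done with absolute extensors for normal spaces. A simplex is one
by Tietze's theorem, and so is the union of two of them whose intersection is
one (absolute_extensorU); this replaces all homotopy extension arguments. It
follows inductively that every A y has a realization which is an absolute
extensor (absolute_extensor_carrier, qc_invariant_merge). At each stage at most
one point y has the triangle sigma in A y, and A y :\ sigma deforms into the
boundary of sigma: initially it is that boundary, and a reduction enlarges it
by gluing an absolute extensor along an absolute extensor, which can be pushed
back (deforms_intoU). At the end there is a maximum, carrying the whole of L,
so that L :\ sigma deforms into the boundary of sigma.

It remains to treat cubes in this boundary. The line covers it by the radial
projection of the unit circle (boundary_cover), and a map from a cube lifts to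
the line by adding up small angles (lift_polar). If n >= 2 the boundary of the
n-cube is connected, so that a lift of an n-loop is constant there and shrinks
linearly to a constant. The track of the deformation itself, which moves the
base point, is used as a collar around this contraction (ball_filling).
*)

Set Implicit Arguments.
Unset Strict Implicit.
Unset Printing Implicit Defensive.

Import Order.TTheory GRing.Theory Num.Theory.
Import numFieldNormedType.Exports.

Local Open Scope classical_set_scope.
Local Open Scope ring_scope.

(** * Continuity, restriction and pasting *)

Section RealFunctions.
Variables (R : realType) (T : topologicalType).
Implicit Types (f g : T -> R) (x : T).

Lemma ctsD f g x : continuous_at x f -> continuous_at x g ->
  continuous_at x (fun y => f y + g y).
Proof. by move=> cf cg; apply: (@cvgD R R^o T). Qed.

Lemma ctsB f g x : continuous_at x f -> continuous_at x g ->
  continuous_at x (fun y => f y - g y).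
Proof. by move=> cf cg; apply: (@cvgB R R^o T). Qed.

Lemma ctsM f g x : continuous_at x f -> continuous_at x g ->
  continuous_at x (fun y => f y * g y).
Proof. by move=> cf cg; apply: (@cvgM R T). Qed.

Lemma ctsV f x : f x != 0 -> continuous_at x f ->
  continuous_at x (fun y => (f y)^-1).
Proof. by move=> f0 cf; apply: (@cvgV R T). Qed.

Lemma cts_cst (a : R) x : continuous_at x (fun _ : T => a).
Proof. exact: cvg_cst. Qed.

Lemma cts_max f g x : continuous_at x f -> continuous_at x g ->
  continuous_at x (fun y => Num.max (f y) (g y)).
Proof. by move=> cf cg; apply: (@continuous_max R T). Qed.

Lemma cts_min f g x : continuous_at x f -> continuous_at x g ->
  continuous_at x (fun y => Num.min (f y) (g y)).
Proof. by move=> cf cg; apply: (@continuous_min R T). Qed.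

Lemma cts_sum (I : Type) (r : seq I) (P : pred I) (F : I -> T -> R) x :
  (forall i, P i -> continuous_at x (F i)) ->
  continuous_at x (fun y => \sum_(i <- r | P i) F i y).
Proof.
by move=> cF; apply: cvg_big => //; exact: add_continuous.
Qed.

Lemma cts_prod (I : Type) (r : seq I) (P : pred I) (F : I -> T -> R) x :
  (forall i, P i -> continuous_at x (F i)) ->
  continuous_at x (fun y => \prod_(i <- r | P i) F i y).
Proof.
by move=> cF; apply: cvg_big => //; exact: mul_continuous.
Qed.

End RealFunctions.

Lemma cts_pair (T U1 U2 : topologicalType) (f : T -> U1) (g : T -> U2) (x : T) :
  continuous_at x f -> continuous_at x g ->
  continuous_at x (fun y => (f y, g y)).
Proof.
by move=> cf cg; apply: cvg_pair; [exact: cf|exact: cg].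
Qed.

Lemma cts_comp (T U W : topologicalType) (f : T -> U) (g : U -> W) (x : T) :
  continuous_at x f -> continuous_at (f x) g ->
  continuous_at x (fun y => g (f y)).
Proof. by move=> cf cg; exact: (continuous_comp cf cg). Qed.

Section WithinContinuity.
Context {T U W : topologicalType}.
Implicit Types (A : set T) (B : set U).

Lemma within_comp A B (f : T -> U) (g : U -> W) :
  {within A, continuous f} -> (forall x, A x -> B (f x)) ->
  {within B, continuous g} -> {within A, continuous (g \o f)}.
Proof.
move=> /subspace_continuousP cf AB /subspace_continuousP cg.
apply/subspace_continuousP => x Ax P /(cg _ (AB _ Ax)) /(cf _ Ax) Pfx.
move: Pfx; rewrite !nbhs_simpl /=; apply: (@filterS _ (nbhs x)) => y h Ay.
exact: h Ay (AB _ Ay).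
Qed.

Lemma within_eq A (f g : T -> U) :
  (forall x, A x -> f x = g x) -> {within A, continuous f} ->
  {within A, continuous g}.
Proof.
move=> fg; apply: subspace_eq_continuous => x /set_mem Ax.
exact: fg.
Qed.

Lemma closed_within A B (f : T -> U) :
  closed A -> closed B -> {within A, continuous f} -> closed (A `&` f @^-1` B).
Proof.
move=> cA cB /continuous_closedP cf; rewrite closed_setSI//; exact: cf.
Qed.

End WithinContinuity.

Lemma within_ptwsP {T : topologicalType} {V : choiceType} {K : uniformType}
    (A : set T) (f : T -> {ptws V -> K}) :
  {within A, continuous f} <->
  forall v, {within A, continuous (fun x => f x v)}.
Proof.
split=> [cf v|cf].
  apply: (@within_comp T {ptws V -> K} K A setT f (fun g => g v)) => //.
  exact/continuous_subspaceT/proj_continuous.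
apply/subspace_continuousP => x Ax.
apply/cvg_sup => v.
have := cf v => /subspace_continuousP /(_ _ Ax) cfv P [Q [[B oB <-] /= Bx BP]].
apply: (@filterS _ _ _ (_ @^-1` B)); first exact: BP.
by apply: cfv; exact: open_nbhs_nbhs.
Qed.

Lemma continuous_ptwsP {T : topologicalType} {V : choiceType} {K : uniformType}
    (f : T -> {ptws V -> K}) :
  continuous f <-> forall v, continuous (fun x => f x v).
Proof.
split=> [/continuous_subspaceT-/(_ setT)/within_ptwsP cf v|cf].
  exact/continuous_subspace_setT/cf.
apply/continuous_subspace_setT/within_ptwsP => v.
exact/continuous_subspaceT/cf.
Qed.

Lemma within_paste {T U : topologicalType} (A B : set T) (f g : T -> U)
    (P : T -> bool) :
  closed A -> closed B ->
  {within A, continuous f} -> {within B, continuous g} ->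
  (forall x, A x -> ~~ P x -> B x -> f x = g x) ->
  (forall x, B x -> P x -> A x -> f x = g x) ->
  (forall x, A x -> ~~ P x -> B x) ->
  (forall x, B x -> P x -> A x) ->
  {within A `|` B, continuous (fun x => if P x then f x else g x)}.
Proof.
move=> cA cB cf cg h1 h2 h3 h4; apply: withinU_continuous => //.
  apply: within_eq cf => x Ax; case: ifPn => // Px.
  exact: (h1 _ Ax Px (h3 _ Ax Px)).
apply: within_eq cg => x Bx; case: ifPn => // Px.
by rewrite (h2 _ Bx Px (h4 _ Bx Px)).
Qed.

Lemma within_pair (T U W : topologicalType) (A : set T)
    (f : T -> U) (g : T -> W) :
  {within A, continuous f} -> {within A, continuous g} ->
  {within A, continuous (fun x => (f x, g x))}.
Proof.
by move=> cf cg x; apply: cts_pair; [exact: cf|exact: cg].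
Qed.

Lemma within_set_val (T U : topologicalType) (S : set U) (A : set T)
    (f : T -> set_type S) :
  {within A, continuous f} <-> {within A, continuous (fun x => set_val (f x))}.
Proof.
split=> [cf|cf].
  apply: (@within_comp _ _ _ A setT f set_val cf) => //.
  exact/continuous_subspaceT/initial_continuous.
exact: (@continuous_comp_initial _ (subspace A) U (@set_val U S) f cf).
Qed.

(** * Absolute extensors *)

Section AbsoluteExtensor.
Variable R : realType.

(** The normal spaces are those to which Tietze's theorem applies; with A empty,
    extension over a nonempty space makes S nonempty. *)
Definition absolute_extensor {T : topologicalType} (S : set T) :=
  forall M : topologicalType, normal_space M ->
  forall (A : set M) (f : M -> T), closed A -> {within A, continuous f} ->
  (forall x, A x -> S (f x)) ->
  exists g : M -> T, [/\ continuous g, forall x, S (g x)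
    & forall x, A x -> g x = f x].

Lemma closed_within_le (M : topologicalType) (A : set M) (d : M -> R) (a : R) :
  closed A -> {within A, continuous d} -> closed (A `&` [set x | d x <= a]).
Proof. by move=> cA cd; exact: (closed_within cA (@closed_le R a) cd). Qed.

Lemma closed_within_ge (M : topologicalType) (A : set M) (d : M -> R) (a : R) :
  closed A -> {within A, continuous d} -> closed (A `&` [set x | a <= d x]).
Proof. by move=> cA cd; exact: (closed_within cA (@closed_ge R a) cd). Qed.

Lemma tietze (M : topologicalType) (A : set M) (d : M -> R) (b : R) :
  normal_space M -> closed A -> {within A, continuous d} -> 0 < b ->
  (forall x, A x -> `|d x| <= b) ->
  exists g : M -> R, [/\ continuous g, forall x, `|g x| <= b
    & forall x, A x -> g x = d x].
Proof.
move=> nM cA cd b0 db.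
have [g [dg cg gb]] := continuous_bounded_extension nM cA b0 cd db.
by exists g; split=> // x Ax; rewrite -dg ?inE.
Qed.

(** Borsuk's union theorem. The sign of d tells on which side of S1 and S2 a point
    lies. Extending d \o f from A to M by Tietze cuts M along the zero set of the
    extension: f is first extended over this common wall into S1 `&` S2, then
    over each of the two halves, where the wall already has its values. Using a
    separating function d instead of distances keeps the class of all normal
    spaces. *)
Lemma absolute_extensorU (T : topologicalType) (S1 S2 : set T) (d : T -> R)
    (b : R) :
  absolute_extensor S1 -> absolute_extensor S2 ->
  absolute_extensor (S1 `&` S2) ->
  {within S1 `|` S2, continuous d} -> (forall x, S1 x \/ S2 x -> `|d x| <= b) ->
  (forall x, S1 x \/ S2 x -> d x <= 0 -> S1 x) ->
  (forall x, S1 x \/ S2 x -> 0 <= d x -> S2 x) ->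
  absolute_extensor (S1 `|` S2).
Proof.
move=> ae1 ae2 ae0 cd db d1 d2 M nM A f cA cf AS.
have cdf := within_comp cf AS cd.
have [D [cD _ Dd]] : exists g : M -> R,
    [/\ continuous g, forall x, `|g x| <= `|b| + 1
    & forall x, A x -> g x = (d \o f) x].
  apply: (tietze nM cA cdf); first by rewrite ltr_wpDl.
  move=> x /AS /db /le_trans; apply; rewrite (le_trans (ler_norm _))//.
  by rewrite lerDl.
have cDW B : {within B, continuous D} by exact: continuous_subspaceT.
have cle : closed [set x | D x <= 0].
  by rewrite -[X in closed X]setTI; exact: closed_within_le closedT (cDW _).
have cge : closed [set x | 0 <= D x].
  by rewrite -[X in closed X]setTI; exact: closed_within_ge closedT (cDW _).
pose Z := [set x | D x <= 0] `&` [set x | 0 <= D x].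
have cZ : closed Z by exact: closedI.
have fS12 x : (A `&` Z) x -> (S1 `&` S2) (f x).
  by move=> [Ax [/= D0 D1]]; split; [apply: d1|apply: d2];
    rewrite -?[d _]/((d \o f) x) -?Dd//; exact: AS.
have [g0 [cg0 g0S g0f]] := ae0 M nM (A `&` Z) f (closedI cA cZ)
  (continuous_subspaceW (@subIsetl _ A Z) cf) fS12.
(* Extension over one half C, starting from the values g0 on the wall Z. *)
have ext (S : set T) (C : set M) : absolute_extensor S -> closed C ->
    Z `<=` C -> (forall x, A x -> C x -> S (f x)) -> (forall x, S (g0 x)) ->
    exists g : M -> T, [/\ continuous g, forall x, S (g x),
     forall x, A x -> C x -> g x = f x & forall x, Z x -> g x = g0 x].
  move=> aeS cC ZC ACS g0S1.
  pose f1 x := if `[<Z x>] then g0 x else f x.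
  have [|||g [cg gS gf]] := aeS M nM (Z `|` (A `&` C)) f1.
  - exact: (closedU cZ (closedI cA cC)).
  - apply: within_paste => //.
    + exact: (closedI cA cC).
    + exact: continuous_subspaceT.
    + exact: continuous_subspaceW cf.
    + by move=> x Zx /asboolPn.
    + by move=> x [Ax _] /asboolP Zx _; exact: g0f.
    + by move=> x Zx /asboolPn.
    + by move=> x _ /asboolP.
  - by rewrite /f1 => x; case: asboolP => // nZ [//|[Ax Cx]]; exact: ACS.
  exists g; split => // x.
  + move=> Ax Cx; rewrite gf; last by right.
    by rewrite /f1; case: asboolP => // Zx; exact: g0f.
  + by move=> Zx; rewrite gf; [rewrite /f1; case: asboolP|left].
have [|||g1 [cg1 g1S g1f g1Z]] := ext S1 [set x | D x <= 0] ae1 cle.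
- exact: subIsetl.
- by move=> x Ax; rewrite /= Dd// => /d1; apply; exact: AS.
- by move=> x; case: (g0S x).
have [|||g2 [cg2 g2S g2f g2Z]] := ext S2 [set x | 0 <= D x] ae2 cge.
- exact: subIsetr.
- by move=> x Ax; rewrite /= Dd// => /d2; apply; exact: AS.
- by move=> x; case: (g0S x).
exists (fun x => if D x <= 0 then g1 x else g2 x); split.
- apply/continuous_subspace_setT.
  rewrite (_ : setT = [set x | D x <= 0] `|` [set x | 0 <= D x]); last first.
    by rewrite eqEsubset; split => x //= _; exact/orP/le_total.
  apply: within_paste => //; try exact: continuous_subspaceT.
  + by move=> x /= ->.
  + by move=> x /= h1 h2 _; rewrite g1Z// g2Z.
  + by move=> x /= ->.
- by move=> x; case: ifP => _; [left|right].
- move=> x Ax; case: ifPn => [/g1f-/(_ Ax)//|]; rewrite -ltNge => /ltW.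
  exact: g2f.
Qed.

End AbsoluteExtensor.

(** * Polyhedra *)

Section Polyhedra.
Variables (R : realType) (V : finType).
Implicit Types (K : {set {set V}}) (s t : {set V}) (x : {ptws V -> R}).

Local Notation W := ({ptws V -> R}).
Local Notation poly K := (@polyhedron V R K).

Lemma polyhedronU K1 K2 : poly (K1 :|: K2) = poly K1 `|` poly K2.
Proof.
rewrite eqEsubset; split=> x.
  by case=> x0 x1; rewrite finset.inE => /orP[] xK; [left|right]; split.
by case=> -[x0 x1 xK]; split=> //; rewrite finset.inE xK ?orbT.
Qed.

Lemma polyhedronI K1 K2 : poly (K1 :&: K2) = poly K1 `&` poly K2.
Proof.
rewrite eqEsubset; split=> x.
  by case=> x0 x1; rewrite finset.inE => /andP[xK1 xK2]; split; split.
by case=> -[x0 x1 xK1] [_ _ xK2]; split=> //; rewrite finset.inE xK1.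
Qed.

Lemma polyhedron_sub K1 K2 : K1 \subset K2 -> poly K1 `<=` poly K2.
Proof. by move=> /fintype.subsetP sK x [x0 x1 /sK xK]; split. Qed.

Lemma coord_ptws_continuous (v : V) : continuous (fun x : W => x v).
Proof. exact: (@proj_continuous V (fun=> R) v). Qed.

Lemma polyhedron_le1 K x v : poly K x -> 0 <= x v <= 1.
Proof.
move=> [x0 <- _]; rewrite x0 /= (bigD1 v)//= lerDl.
by apply: sumr_ge0.
Qed.

(** On points with nonnegative coordinates, a continuous function whose zero set
    is the polyhedron of K: a term is positive exactly when all the vertices of
    a non-face of K are charged. It serves both to show that polyhedra are
    closed and to separate two of them. *)
Definition defect K x : R :=
  \sum_(t : {set V} | (t \notin K) && (t != finset.set0)) \prod_(v in t) x v.

Lemma defect_continuous K : continuous (defect K).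
Proof.
move=> x; apply: cts_sum => t _; apply: cts_prod => v _.
exact: coord_ptws_continuous.
Qed.

Lemma defect_ge0 K x : (forall v, 0 <= x v) -> 0 <= defect K x.
Proof. by move=> x0; apply: sumr_ge0 => t _; exact: prodr_ge0. Qed.

Lemma defect_le K K' x : poly K' x -> defect K x <= #|{set V}|%:R.
Proof.
move=> xK; rewrite (@le_trans _ _ (\sum_(t : {set V}) 1%R))//; last first.
  by rewrite sumr_const.
rewrite /defect big_mkcond; apply: ler_sum => t _; case: ifP => // _.
rewrite (@le_trans _ _ (\prod_(v in t) 1))//; last by rewrite big1_eq.
by apply: ler_prod => v _; exact: polyhedron_le1 xK.
Qed.

Lemma defect0 K x : simplicial_complex K -> poly K x -> defect K x = 0.
Proof.
move=> [_ Kdown] [x0 _ xK]; apply: big1 => t /andP[tK t0].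
have [v vt xv] : exists2 v, v \in t & x v = 0.
  apply: contrapT => nv; case/negP: tK; apply: Kdown _ _ xK _ t0.
  apply/fintype.subsetP => v vt; rewrite finset.inE; apply/eqP => xv.
  by apply: nv; exists v.
by rewrite (bigD1 v)//= xv mul0r.
Qed.

Lemma defect_eq0 K K' x : poly K' x -> defect K x = 0 -> poly K x.
Proof.
move=> [x0 x1 xK'] qx; split=> //; apply: contraT => sK.
set s := [set v | _]%SET in sK.
have s0 : s != finset.set0.
  apply: contraPneq x1 => s0; rewrite big1 => [|v _].
    by apply/eqP; rewrite eq_sym oner_eq0.
  by apply/eqP; have := finset.in_set0 v; rewrite -s0 finset.inE => /negbFE.
move: qx; rewrite /defect (bigD1 s)/= ?sK ?s0//.
have : 0 < \prod_(v in s) x v.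
  by apply: prodr_gt0 => v; rewrite finset.inE lt_neqAle eq_sym x0 andbT.
set a := \prod_(v in s) _; set b := \sum_(_ | _) _ => a0.
have : 0 <= b by apply: sumr_ge0 => t _; apply: prodr_ge0.
by move=> b0 ab; have := ltr_wpDr b0 a0; rewrite ab ltxx.
Qed.

(** The values of f are required to lie in some polyhedron, possibly bigger, so
    that only the support condition is at stake. *)
Lemma polyhedron_closed K (T : topologicalType) (A : set T) (f : T -> W) K' :
  simplicial_complex K -> closed A -> {within A, continuous f} ->
  (forall z, A z -> poly K' (f z)) -> closed (A `&` [set z | poly K (f z)]).
Proof.
move=> hK cA cf fK'.
have cq : {within A, continuous (defect K \o f)}.
  apply: (@within_comp _ _ _ A setT) => //.
  exact/continuous_subspaceT/defect_continuous.
rewrite (_ : _ `&` _ = A `&` [set z | (defect K \o f) z <= 0]).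
  exact: closed_within_le.
rewrite eqEsubset; split=> z [Az /= h]; split=> //=.
  by rewrite defect0.
have /fK' fz := Az; apply: defect_eq0 (fz) _.
by apply/eqP; rewrite eq_le h defect_ge0//; case: fz.
Qed.

Lemma simplicial_complexU K1 K2 : simplicial_complex K1 ->
  simplicial_complex K2 -> simplicial_complex (K1 :|: K2).
Proof.
move=> [n1 d1] [n2 d2]; split; first by rewrite finset.inE negb_or n1.
move=> s t; rewrite !finset.inE => /orP[sK|sK] ts t0.
  by rewrite (d1 s).
by rewrite (d2 s) ?orbT.
Qed.

Lemma absolute_extensor_polyhedronU K1 K2 :
  simplicial_complex K1 -> simplicial_complex K2 ->
  absolute_extensor (poly K1) -> absolute_extensor (poly K2) ->
  absolute_extensor (poly (K1 :&: K2)) ->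
  absolute_extensor (poly (K1 :|: K2)).
Proof.
move=> hK1 hK2 ae1 ae2; rewrite polyhedronI polyhedronU => ae0.
have qE x : poly K1 x \/ poly K2 x -> defect K1 x = 0 \/ defect K2 x = 0.
  by case=> xK; [left|right]; exact: defect0.
have q0 K x : poly K1 x \/ poly K2 x -> 0 <= defect K x.
  by case=> -[x0 _ _]; exact: defect_ge0.
have qp K x : poly K1 x \/ poly K2 x -> defect K x = 0 -> poly K x.
  by case=> xK; apply: defect_eq0 xK.
have qb K x : poly K1 x \/ poly K2 x -> defect K x <= #|{set V}|%:R.
  by case=> xK; apply: defect_le xK.
apply: (@absolute_extensorU _ _ _ _ (fun x => defect K1 x - defect K2 x)
   (#|{set V}|%:R)) => //.
- apply: continuous_subspaceT => x.
  by apply: ctsB; exact: defect_continuous.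
- move=> x xK; have := qE _ xK => -[] ->; rewrite ?sub0r ?subr0 ?normrN.
    by rewrite ger0_norm ?qb ?q0.
  by rewrite ger0_norm ?qb ?q0.
- move=> x xK h; apply: qp => //; case: (qE _ xK) => // q2.
  by apply/eqP; rewrite eq_le q0// andbT; move: h; rewrite q2 subr0.
- move=> x xK h; apply: qp => //; case: (qE _ xK) => // q1.
  by apply/eqP; rewrite eq_le q0// andbT; move: h; rewrite q1 sub0r oppr_ge0.
Qed.

Definition simplex s : {set {set V}} :=
  [set t : {set V} | (t != finset.set0) && (t \subset s)]%SET.

Lemma simplicial_complex_simplex s : simplicial_complex (simplex s).
Proof.
split=> [|t u]; first by rewrite finset.inE eqxx.
rewrite !finset.inE => /andP[_ ts] ut ->.
exact: fintype.subset_trans ut ts.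
Qed.

(** Each barycentric coordinate is extended by Tietze. The extended coordinates
    are made nonnegative and divided by their sum when it exceeds 1; the mass
    that is then missing is put on a chosen vertex v0. None of this changes a
    point which already was in the simplex. *)
Lemma absolute_extensor_simplex s : s != finset.set0 ->
  absolute_extensor (poly (simplex s)).
Proof.
move=> /finset.set0Pn[v0 v0s] M nM A f cA cf fs.
have fs1 z v : A z -> v \notin s -> f z v = 0.
  move=> /fs[_ _]; rewrite finset.inE => /andP[_ /fintype.subsetP h] vs.
  apply/eqP; have := contraNN (h v) vs.
  by rewrite finset.inE negbK.
have cfv := iffLR (within_ptwsP _ _) cf.
have /choice[g gP] : forall v, exists g : M -> R, [/\ continuous g,
    forall z, 0 <= g z, v \notin s -> forall z, g z = 0
    & forall z, A z -> g z = f z v].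
  move=> v; have [vs|vs] := boolP (v \in s); last first.
    exists (fun=> 0); split=> //; first by move=> z; exact: cts_cst.
    by move=> z Az; rewrite fs1.
  have [|g [cg _ gf]] := @tietze _ _ _ _ 1 nM cA (cfv v) ltr01.
    move=> z /fs /polyhedron_le1 -/(_ v) /andP[f0 f1].
    by rewrite ger0_norm.
  exists (fun z => Num.max (g z) 0); split=> //.
  - by move=> z; apply: cts_max; [exact: cg|exact: cts_cst].
  - by move=> z; rewrite le_max lexx orbT.
  - by move=> z Az; rewrite gf// max_l//; case: (fs _ Az).
pose n z := Num.max 1 (\sum_v g v z).
have n1 z : 1 <= n z by rewrite le_max lexx.
have n0 z : 0 < n z by exact: lt_le_trans (n1 z).
have cS : continuous (fun z => \sum_v g v z).
  by move=> z; apply: cts_sum => v _; case: (gP v) => + *; exact.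
have cn : continuous n.
  by move=> z; apply: cts_max; [exact: cts_cst|exact: cS].
pose h z : W := fun v =>
  g v z / n z + (v == v0)%:R * (1 - (\sum_w g w z) / n z).
have cN : continuous (fun z => (n z)^-1).
  by move=> z; apply: ctsV; rewrite ?gt_eqF//; exact: cn.
have r0 z : 0 <= 1 - (\sum_w g w z) / n z.
  by rewrite subr_ge0 ler_pdivrMr// mul1r le_max lexx orbT.
have h0 z v : 0 <= h z v.
  apply: addr_ge0; last by rewrite mulr_ge0.
  by rewrite divr_ge0 ?(ltW (n0 z))//; case: (gP v).
exists h; split.
- apply/continuous_ptwsP => v z.
  apply: ctsD; first by apply: ctsM; [case: (gP v) => + *; exact|exact: cN].
  apply: ctsM; first exact: cts_cst.
  apply: ctsB; first exact: cts_cst.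
  by apply: ctsM; [exact: cS|exact: cN].
- move=> z.
  have sh : \sum_v h z v = 1.
    rewrite big_split /= -mulr_suml [X in _ + X](bigD1 v0)//= eqxx mul1r.
    rewrite [\sum_(_ | _ != _) _]big1 ?addr0 => [|v /negPf->]; last first.
      by rewrite mul0r.
    by rewrite addrC subrK.
  split=> //; rewrite finset.inE; apply/andP; split.
    apply: contraPneq sh => s0; rewrite big1 => [|v _].
      by apply/eqP; rewrite eq_sym oner_eq0.
    by apply/eqP; have := finset.in_set0 v; rewrite -s0 finset.inE => /negbFE.
  apply/fintype.subsetP => v; rewrite finset.inE; apply: contraNT => vs.
  case: (gP v) => _ _ /(_ vs) gv0 _; rewrite /h gv0 mul0r add0r; apply/eqP.
  have [ev|_] := eqVneq v v0; last by rewrite mul0r.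
  by rewrite ev v0s in vs.
- move=> z Az; apply/funext => v; rewrite /h.
  have -> : \sum_w g w z = 1.
    have [_ <- _] := fs _ Az; apply: eq_bigr => w _.
    by case: (gP w) => _ _ _ ->.
  have -> : n z = 1.
    rewrite /n (_ : \sum_w g w z = 1) ?maxxx//.
    have [_ <- _] := fs _ Az; apply: eq_bigr => w _.
    by case: (gP w) => _ _ _ ->.
  by rewrite !divr1 subrr mulr0 addr0; case: (gP v) => _ _ _ ->.
Qed.

End Polyhedra.

(** * Deformation into a subcomplex *)

Section Deformation.
Variables (R : realType) (V : finType).
Implicit Types K C G B : {set {set V}}.

Local Notation W := ({ptws V -> R}).
Local Notation poly K := (@polyhedron V R K).

(** Every family of points of K, indexed by a closed subset D of a space Z, can be
    moved inside K to a family in C. With D and Z arbitrary, this passes to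
    unions by extending maps over the cylinder Z * R, and taking for D the
    polyhedron of K itself gives an actual homotopy. *)
Definition deforms_into C K :=
  forall Z : topologicalType, normal_space Z ->
  normal_space ((Z * R)%type : topologicalType) ->
  forall (D : set Z) (f : Z -> W), closed D -> {within D, continuous f} ->
  (forall z, D z -> poly K (f z)) ->
  exists h : Z * R -> W, [/\ {within D `*` setT, continuous h},
    forall z t, D z -> poly K (h (z, t)),
    forall z, D z -> h (z, 0) = f z & forall z, D z -> poly C (h (z, 1))].

Lemma deforms_into_refl C : deforms_into C C.
Proof.
move=> Z nZ nZR D f cD cf fC; exists (f \o fst); split; first last.
- by move=> z Dz; exact: fC.
- by [].
- by move=> z t Dz; exact: fC.
apply: (within_comp _ _ cf); last by move=> [z t] [].
by apply: continuous_subspaceT => x; exact: cvg_fst.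
Qed.

Lemma closed_rect (Z : topologicalType) (D : set Z) (I : set R) :
  closed D -> closed I -> closed (D `*` I).
Proof.
move=> cD cI; rewrite (_ : D `*` I = fst @^-1` D `&` snd @^-1` I)//.
apply: closedI.
  by apply: preimage_closed => // x _; exact: cvg_fst.
by apply: preimage_closed => // x _; exact: cvg_snd.
Qed.

(** B is pushed into G :&: B while G stands still. The end map r of this push is an
    extension into G :&: B of f on the part of D sent to G :&: B; the push
    itself is an extension into B of the map equal to f at times t <= 0, to r at
    times t >= 1, and constantly to f over that part of D. The family then lies
    in G, and the deformation of G is run after the push. *)
Lemma deforms_intoU C G B : simplicial_complex G -> simplicial_complex B ->
  absolute_extensor (poly B) -> absolute_extensor (poly (G :&: B)) ->
  deforms_into C G -> deforms_into C (G :|: B).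
Proof.
move=> hG hB aeB aeT GC Z nZ nZR D f cD cf fK.
pose DG := D `&` [set z | poly G (f z)].
pose DB := D `&` [set z | poly B (f z)].
have cDG : closed DG by exact: polyhedron_closed fK.
have cDB : closed DB by exact: polyhedron_closed fK.
have cDT : closed (DG `&` DB) by exact: closedI.
have [||r [cr rT rf]] := aeT Z nZ (DG `&` DB) f cDT.
- by apply: continuous_subspaceW cf => z [[]].
- by move=> z [[_ fG] [_ fB]]; rewrite polyhedronI; split.
(* Half-lines of times replace the end points 0 and 1, which makes e a map with
   two closed pieces. *)
pose X1 : set (Z * R) := setT `*` [set t | 1 <= t].
pose X2 : set (Z * R) := (DB `*` [set t | t <= 0]) `|` ((DG `&` DB) `*` setT).
have cX1 : closed X1 by apply: closed_rect; [exact: closedT|exact: closed_ge].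
have cX2 : closed X2.
  by apply: closedU; apply: closed_rect => //; exact: closed_le.
pose e (x : Z * R) := if 1 <= x.2 then r x.1 else f x.1.
have cffst (A : set (Z * R)) : (forall x, A x -> D x.1) ->
    {within A, continuous (f \o fst)}.
  move=> AD; apply: (within_comp _ AD cf).
  by apply: continuous_subspaceT => x; exact: cvg_fst.
have ce : {within X1 `|` X2, continuous e}.
  apply: (@within_paste _ _ X1 X2 (r \o fst) (f \o fst)) => //.
  - apply: continuous_subspaceT => x.
    apply: continuous_comp; [exact: cvg_fst|exact: cr].
  - by apply: cffst => -[z t] [[[]]|[[[]]]].
  - by move=> [z t] /= [_ /= ->].
  - move=> [z t] [[_ /= t0]|[/= zT _]] /= t1 _; last by rewrite rf.
    by have := le_trans t1 t0; rewrite ler10.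
  - by move=> [z t] /= [_ /= ->].
have eX x : (X1 `|` X2) x -> poly B (e x).
  case: x => z t; rewrite /e /= => X12; case: ifPn => t1.
    by have := rT z; rewrite polyhedronI => -[].
  by case: X12 => [[_ /= h]|[[[]]|[[_ []]]]]//; rewrite h in t1.
have [b [cb bB be]] := aeB _ nZR _ e (closedU cX1 cX2) ce eX.
pose h1 (x : Z * R) := if `[<poly G (f x.1)>] then f x.1 else b x.
have DU z : D z -> DG z \/ DB z.
  by move=> Dz; have := fK _ Dz; rewrite polyhedronU => -[]; [left|right].
have ch1 : {within D `*` setT, continuous h1}.
  rewrite (_ : _ `*` _ = (DG `*` setT) `|` (DB `*` setT)); last first.
    rewrite eqEsubset; split=> -[z t].
      by move=> [/DU [] ? _]; [left|right].
    by move=> [] [[]].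
  apply: within_paste.
  - by apply: closed_rect => //; exact: closedT.
  - by apply: closed_rect => //; exact: closedT.
  - by apply: cffst => -[z t] [[]].
  - exact: continuous_subspaceT.
  - by move=> [z t] [[_ /=]] + _ /asboolPn.
  - move=> [z t] [/= zB _] /= /asboolP zG _.
    have zT : (DG `&` DB) z by split=> //; split=> //; case: zB.
    rewrite be; last by right; right.
    by rewrite /e /=; case: ifP => // _; rewrite rf.
  - by move=> [z t] [[_ /=]] + _ /asboolPn.
  - by move=> [z t] [[/= Dz _] _] /= /asboolP zG.
have h1K z t : D z -> poly (G :|: B) (h1 (z, t)).
  move=> Dz; rewrite /h1 /=; case: ifP => _; first exact: fK.
  by rewrite polyhedronU; right.
have h10 z : D z -> h1 (z, 0) = f z.
  move=> Dz; rewrite /h1 /=; case: asboolP => // nG.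
  have zB : DB z by case: (DU _ Dz) => // -[].
  by rewrite be /e /= ?ler10//; right; left; split => //=.
have h11 z : D z -> poly G (h1 (z, 1)).
  move=> Dz; rewrite /h1 /=; case: asboolP => // nG.
  rewrite be /e /= ?lexx//; last by left; split => //=.
  by have := rT z; rewrite polyhedronI => -[].
have pairc (u : R) : continuous (fun z : Z => (z, u)).
  by move=> z; apply: cts_pair; [exact: cvg_id|exact: cvg_cst].
have cf1 : {within D, continuous (fun z => h1 (z, 1))}.
  have pD z : D z -> (D `*` setT) ((fun z : Z => (z, 1 : R)) z) by [].
  exact: (within_comp (continuous_subspaceT (pairc 1)) pD ch1).
have [h2 [ch2 h2G h20 h2C]] := GC Z nZ nZR D (fun z => h1 (z, 1)) cD cf1 h11.
pose h (x : Z * R) :=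
  if x.2 <= 2^-1 then h1 (x.1, 2 * x.2) else h2 (x.1, 2 * x.2 - 1).
have caff (a c : R) : continuous (fun x : Z * R => (x.1, a * x.2 - c)).
  move=> x; apply: cts_pair; first exact: cvg_fst.
  apply: ctsB; last exact: cts_cst.
  by apply: ctsM; [exact: cts_cst|exact: cvg_snd].
exists h; split.
- rewrite (_ : _ `*` _ = (D `*` [set t | t <= 2^-1]) `|`
      (D `*` [set t | 2^-1 <= t])); last first.
    rewrite eqEsubset; split=> -[z t].
      by move=> [Dz _]; case/orP: (le_total t 2^-1) => t2; [left|right].
    by move=> [] [].
  apply: (within_paste (f := fun x : Z * R => h1 (x.1, 2 * x.2))
    (g := fun x : Z * R => h2 (x.1, 2 * x.2 - 1))).
  - by apply: closed_rect => //; exact: closed_le.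
  - by apply: closed_rect => //; exact: closed_ge.
  - have := caff 2 0; under [X in continuous X -> _]eq_fun do rewrite subr0.
    move=> /continuous_subspaceT c2; apply: (within_comp (c2 _) _ ch1).
    by move=> [z t] [].
  - apply: (within_comp (continuous_subspaceT (caff 2 1)) _ ch2).
    by move=> [z t] [].
  - by move=> [z t] [_ /= ->].
  - move=> [z t] [/= Dz t2] /= t2' _.
    have -> : t = 2^-1 by apply/eqP; rewrite eq_le t2 t2'.
    by rewrite divff// subrr h20.
  - by move=> [z t] [_ /= ->].
  - by move=> [z t] [/= Dz _] /= t2.
- move=> z t Dz; rewrite /h /=; case: ifP => _; first exact: h1K.
  by rewrite polyhedronU; left; exact: h2G.
- by move=> z Dz; rewrite /h /= invr_ge0 ler0n mulr0 h10.
- move=> z Dz; rewrite /h /= ifF; last first.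
    by apply/negbTE; rewrite -ltNge invf_lt1 ?ltr1n.
  by rewrite mulr1 -[2]natr1 addrK; exact: h2C.
Qed.

End Deformation.

(** * Contractible finite spaces and beat points *)

Section Fences.
Context {d : Order.disp_t} {X : finPOrderType d}.
Implicit Types (D T : {set X}) (f g r : X -> X) (x y z a b : X).

Local Open Scope order_scope.

Definition monotone_into D D' f :=
  (forall x, x \in D -> f x \in D') /\
  (forall x y, x \in D -> y \in D -> x <= y -> f x <= f y).

Definition fence_step D f g :=
  [/\ monotone_into D D f, monotone_into D D g &
    forall x, x \in D -> f x <= g x].

(** By finiteness, homotopy classes of continuous self-maps of a finite space are
    the classes of monotone maps for the equivalence relation generated by the
    pointwise order. *)
Definition fence D := clos_refl_sym_trans _ (fence_step D).

Definition fence_contractible D :=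
  exists2 x0, x0 \in D &
  exists2 g, fence D id g & forall x, x \in D -> g x = x0.

Definition up_beat D x :=
  exists2 y, y \in D & x < y /\ forall z, z \in D -> x < z -> y <= z.

Definition down_beat D x :=
  exists2 y, y \in D & y < x /\ forall z, z \in D -> z < x -> z <= y.

(** Going up by induction, f fixes every point strictly below x; if f x < x, then
    f x would be the largest point strictly below x and x a down beat point. *)
Lemma monotone_le_id D f : (forall x, x \in D -> ~ down_beat D x) ->
  monotone_into D D f -> (forall x, x \in D -> f x <= x) ->
  forall x, x \in D -> f x = x.
Proof.
move=> nD [fD fm] fle x.
have [n] := ubnP #|[set y in D | (y < x)%O]|%SET.
elim: n x => // n IH x lt_n xD.
have fy y : y \in D -> y < x -> f y = y.
  move=> yD yx; apply: IH => //; rewrite -ltnS; apply: leq_trans lt_n.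
  apply: proper_card; apply/fintype.properP; split.
    apply/fintype.subsetP => z; rewrite !finset.inE => /andP[-> zy] /=.
    exact: lt_trans zy yx.
  by exists y; rewrite !finset.inE ?yD ?yx ?ltxx ?andbF.
apply/eqP; rewrite eq_le fle//=; apply: contraT => nle; exfalso.
have fx : f x < x by rewrite lt_leAnge fle.
apply: (nD x xD); exists (f x); first exact: fD.
by split=> // z zD zx; rewrite -(fy z zD zx); apply: fm => //; exact: ltW.
Qed.

Lemma monotone_ge_id D f : (forall x, x \in D -> ~ up_beat D x) ->
  monotone_into D D f -> (forall x, x \in D -> x <= f x) ->
  forall x, x \in D -> f x = x.
Proof.
move=> nD [fD fm] fge x.
have [n] := ubnP #|[set y in D | (x < y)%O]|%SET.
elim: n x => // n IH x lt_n xD.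
have fy y : y \in D -> x < y -> f y = y.
  move=> yD yx; apply: IH => //; rewrite -ltnS; apply: leq_trans lt_n.
  apply: proper_card; apply/fintype.properP; split.
    apply/fintype.subsetP => z; rewrite !finset.inE => /andP[-> zy] /=.
    exact: lt_trans yx zy.
  by exists y; rewrite !finset.inE ?yD ?yx ?ltxx ?andbF.
apply/eqP; rewrite eq_le fge// andbT; apply: contraT => nle; exfalso.
have fx : x < f x by rewrite lt_leAnge fge.
apply: (nD x xD); exists (f x); first exact: fD.
by split=> // z zD zx; rewrite -(fy z zD zx); apply: fm => //; exact: ltW.
Qed.

(** Stong's theorem: without beat points, a monotone map comparable to the
    identity is the identity, so the fence never leaves the identity, which
    would then be constant. *)
Lemma beat_point_exists D a b : fence_contractible D ->
  a \in D -> b \in D -> a != b ->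
  exists2 x, x \in D & up_beat D x \/ down_beat D x.
Proof.
move=> [x0 x0D [g idg gx0]] aD bD; apply: contraNP => nbeat.
have nu x : x \in D -> ~ up_beat D x.
  by move=> xD ux; apply: nbeat; exists x => //; left.
have nd x : x \in D -> ~ down_beat D x.
  by move=> xD ux; apply: nbeat; exists x => //; right.
pose isid f := forall x, x \in D -> f x = x.
suff idgE : isid id <-> isid g.
  have gid : isid g by apply/idgE.
  by rewrite -(gid _ aD) -(gid _ bD) !gx0.
elim: idg {gx0} => [f h [mf mh fh]|f|f h _ IH|f h k _ IH1 _ IH2].
- split=> [fid|hid].
    by apply: monotone_ge_id => // x xD; rewrite -{1}(fid _ xD) fh.
  by apply: monotone_le_id => // x xD; rewrite -{2}(hid _ xD) fh.
- by [].
- by split=> /IH.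
- by split=> [/IH1/IH2|/IH2/IH1].
Qed.

Lemma fence_contractible_retract D D' r : D' \subset D ->
  monotone_into D D' r -> (forall x, x \in D' -> r x = x) ->
  fence_contractible D -> fence_contractible D'.
Proof.
move=> /fintype.subsetP sD [rD rm] rid [x0 x0D [g idg gx0]].
have stepr f h : fence D f h -> fence D' (r \o f) (r \o h).
  have mr f' : monotone_into D D f' -> monotone_into D' D' (r \o f').
    move=> [f'D f'm]; split=> [x xD|x y xD yD xy] /=; first exact/rD/f'D/sD.
    by apply: rm; [exact/f'D/sD|exact/f'D/sD|apply: f'm => //; exact: sD].
  elim=> [f1 h1 [mf mh fh]|f1|f1 h1 _|f1 h1 k _ + _].
  - apply: rst_step; split; [exact: mr|exact: mr|].
    move=> x xD /=; apply: rm; last exact/fh/sD.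
      by case: mf => + _; apply; exact: sD.
    by case: mh => + _; apply; exact: sD.
  - exact: rst_refl.
  - exact: rst_sym.
  - exact: rst_trans.
exists (r x0); first exact: rD.
exists (r \o g); last by move=> x /sD xD /=; rewrite gx0.
apply: rst_trans (stepr _ _ idg); apply: rst_step; split=> //.
- split=> [x xD|x y xD yD xy] /=; first exact/rD/sD.
  by apply: rm => //; exact: sD.
- by move=> x xD /=; rewrite rid.
Qed.

Lemma fence_contractible_beat D x : x \in D -> up_beat D x \/ down_beat D x ->
  fence_contractible D -> fence_contractible (D :\ x).
Proof.
move=> xD beat.
have [y yD [yx rm]] : exists2 y, y \in D & y != x /\ forall z w,
    z \in D -> w \in D -> z <= w ->
    (if z == x then y else z) <= (if w == x then y else w).
  case: beat => -[y yD [yx h]]; exists y => //; split.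
  - by rewrite gt_eqF.
  - move=> z w zD wD zw.
    case: (eqVneq z x) => [zx|zx]; case: (eqVneq w x) => [wx|wx] //.
      by apply: h => //; rewrite lt_neqAle eq_sym wx -zx.
    by rewrite (le_trans zw)// wx ltW.
  - by rewrite lt_eqF.
  - move=> z w zD wD zw.
    case: (eqVneq z x) => [zx|zx]; case: (eqVneq w x) => [wx|wx] //.
      by rewrite (le_trans _ zw)// zx ltW.
    by apply: h => //; rewrite lt_neqAle zx -wx.
apply: (@fence_contractible_retract _ _ (fun z => if z == x then y else z)).
- exact: subD1set.
- split=> [z zD|z w]; last first.
    exact: rm.
  by rewrite !finset.inE; case: (eqVneq z x) => [_|zx]; rewrite ?yx ?zx.
- by move=> z; rewrite !finset.inE => /andP[/negPf->].
Qed.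

(** Points below a only are raised to a, the other points outside of the
    intersection to b. What remains is the non-Hausdorff suspension of the
    intersection of the two lower sets. *)
Lemma fence_contractible_lowerI a b : ~~ (a <= b) -> ~~ (b <= a) ->
  fence_contractible [set x | (x <= a) || (x <= b)]%SET ->
  fence_contractible ([set x | (x <= a) && (x <= b)] :|: [set a; b])%SET.
Proof.
move=> nab nba.
apply: (@fence_contractible_retract _ _
  (fun x => if (x <= a) && (x <= b) then x else if x <= a then a else b)).
- apply/fintype.subsetP => x; rewrite !finset.inE.
  move=> /orP[/andP[->]//|/orP[] /eqP->]; rewrite lexx ?orbT //.
- split=> [x xD|x y].
    case: ifPn => [xab|_]; first by rewrite !finset.inE xab.
    by case: ifPn => _; rewrite !finset.inE eqxx ?orbT.
  rewrite !finset.inE => xD yD xy.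
  have [/andP[ya yb]|] := boolP ((y <= a) && (y <= b)).
    by rewrite !(le_trans xy).
  have [ya|nya] := boolP (y <= a) => /= nyb.
    by rewrite (le_trans xy ya)/=; case: ifP; rewrite ?lexx ?(le_trans xy ya).
  have yb : y <= b by rewrite (negPf nya) in yD.
  rewrite (le_trans xy yb) andbT.
  by case: ifPn => [_|/negPf->]; [exact: le_trans xy yb|exact: lexx].
- move=> x; rewrite !finset.inE => /orP[->//|/orP[] /eqP->].
    by rewrite lexx (negPf nab).
  by rewrite (negPf nba).
Qed.

End Fences.

Lemma locally_constant_itv (R : realType) (P : R -> Prop) :
  (forall t : R, 0 <= t <= 1 ->
     \forall s \near t, 0 <= s <= 1 -> (P s <-> P t)) ->
  P 0 -> P 1.
Proof.
move=> loc P0.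
pose I := [set t : R | 0 <= t <= 1].
have cI : connected I.
  by have := @segment_connected R 0 1; rewrite set_itvE.
suff BE : I `&` P = I.
  have : (I `&` P) 1 by rewrite BE /I /= ler01 lexx.
  by case.
apply: cI.
- by exists 0; split=> //; rewrite /I /= lexx ler01.
- exists (interior [set t | I t -> P t]); first exact: open_interior.
  rewrite eqEsubset; split=> t [It Pt]; split=> //.
    by apply: filterS (loc t It) => s sP /sP ->.
  exact: interior_subset Pt It.
- exists (~` interior [set t | I t -> ~ P t]).
    by apply: open_closedC; exact: open_interior.
  rewrite eqEsubset; split=> t [It Pt]; split=> //.
    by move=> /interior_subset /(_ It).
  apply: contrapT => nPt; apply: Pt.
  by apply: filterS (loc t It) => s sP /sP ->.
Qed.

Section ContractibleFence.
Variable R : realType.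
Context {d : Order.disp_t} {X : finPOrderType d}.

(** If H is a contraction then, by continuity and finiteness, H (-, s) is pointwise
    below H (-, t) for s close to t: the smallest neighbourhood of H (x, t) is
    its lower set. So the fence class of H (-, t) is locally constant in t. *)
Lemma fence_contractible_of_contractible (S : set (poset_space X))
    (D : {set X}) :
  (forall x : X, S x <-> x \in D) -> contractible R (set_type S) ->
  fence_contractible D.
Proof.
move=> SD [x0 [H [cH H0 H1]]].
have vD (s : set_type S) : (set_val s : X) \in D.
  by apply/SD; exact: set_valP.
have near_le (x : set_type S) (t : R) : 0 <= t <= 1 ->
    \forall s \near t, 0 <= s <= 1 -> forall y : set_type S,
    ((set_val y : X) <= (set_val x : X))%O ->
    ((set_val (H (y, s)) : X) <= (set_val (H (x, t)) : X))%O.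
  move=> t01.
  have /subspace_continuousP cH' := cH.
  have [] := cH' (x, t) t01
     [set y : set_type S | ((set_val y : X) <= (set_val (H (x, t)) : X))%O].
    exists [set y : set_type S | ((set_val y : X) <= (set_val (H (x, t)) : X))%O].
    split=> //=.
    exists [set y : poset_space X | ((y : X) <= (set_val (H (x, t)) : X))%O] => //.
    by move=> y z /= yz; exact: le_trans.
  move=> [N1 N2] /= [[_ [[W oW <-] Wx WN1]] tN2] N12.
  apply: filterS tN2 => s N2s s01 y yx.
  apply: (N12 (y, s)) => //=; split=> //=; apply: WN1.
  exact: oW Wx.
pose f (t : R) (x : X) : X :=
  if insub (x : poset_space X) is Some s then
    set_val (H (s : set_type S, t)) else x.
have fE t s : f t (set_val s) = set_val (H (s, t)).
  by rewrite /f (_ : insub _ = Some s)// set_valE valK.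
have lift (x : X) : x \in D -> exists s : set_type S, x = set_val s.
  move=> /SD Sx; exists (exist _ (x : poset_space X) (mem_set Sx)).
  by rewrite set_valE.
have mono t : 0 <= t <= 1 -> monotone_into D D (f t).
  move=> t01; split=> [x /lift[s ->]|x y /lift[r ->] /lift[s ->] rs].
    by rewrite fE.
  by rewrite !fE; exact: (nbhs_singleton (near_le s t t01)).
have f0 : f 0 = id.
  apply/funext => x; rewrite /f; case: insubP => //= s _ sx.
  by rewrite H0; exact: sx.
have fence01 : fence D (f 0) (f 1).
  apply: (@locally_constant_itv R (fun t => fence D (f 0) (f t))); last first.
    exact: rst_refl.
  move=> t t01.
  have : \forall s \near t, forall x : X, 0 <= s <= 1 -> x \in D ->
      (f s x <= f t x)%O.
    apply: (@filter_forall R X (fun x s => 0 <= s <= 1 -> x \in D ->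
      (f s x <= f t x)%O) (nbhs t) _) => x.
    have [/lift[s ->]|xD] := boolP (x \in D); last first.
      by apply: nearW => s _.
    by apply: filterS (near_le s t t01) => u su u01 _; rewrite !fE; exact: su.
  apply: filterS => s st s01.
  have fst' : fence D (f s) (f t).
    by apply: rst_step; split=> [||x xD]; [exact: mono|exact: mono|exact: st].
  split=> h; first exact: rst_trans h fst'.
  exact: rst_trans h (rst_sym _ _ _ _ fst').
exists (set_val x0) => //; exists (f 1); first by rewrite -f0.
by move=> x /lift[s ->]; rewrite fE H1.
Qed.

End ContractibleFence.

(** * Families of subcomplexes carried by a poset *)

Section Carriers.
Variables (R : realType) (V : finType).
Context {d : Order.disp_t}.
Implicit Types (X : finPOrderType d) (s t : {set V}).

Local Notation poly K := (@polyhedron V R K).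

(** The conditions of the nerve lemma for a cover indexed by a poset: the
    intersection of two members is the union of the members below both. *)
Definition carrier X (T : {set X}) (A : X -> {set {set V}}) := [/\
  forall z, z \in T -> simplicial_complex (A z),
  forall z, z \in T -> absolute_extensor (poly (A z)),
  forall y z, y \in T -> z \in T -> (y <= z)%O -> A y \subset A z &
  forall y z t, y \in T -> z \in T -> t \in A y -> t \in A z ->
    exists w, [/\ w \in T, (w <= y)%O, (w <= z)%O & t \in A w]].

Lemma simplicial_complex_bigcup X (T : {set X}) (A : X -> {set {set V}}) :
  (forall z, z \in T -> simplicial_complex (A z)) ->
  simplicial_complex (\bigcup_(z in T) A z)%SET.
Proof.
move=> hA; split.
  by apply/finset.bigcupP => -[z zT]; case: (hA z zT) => /negPf->.
move=> s t /finset.bigcupP[z zT sz] ts t0; apply/finset.bigcupP; exists z => //.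
by case: (hA z zT) => _; apply; first exact: sz.
Qed.

Lemma carrier_max X (T : {set X}) (A : X -> {set {set V}}) y :
  carrier T A -> y \in T -> (forall z, z \in T -> (z <= y)%O) ->
  (\bigcup_(z in T) A z)%SET = A y.
Proof.
move=> [_ _ Am _] yT ymax; apply/eqP; rewrite finset.eqEsubset.
rewrite (finset.bigcup_sup y)// andbT; apply/bigcupsP => z zT.
by apply: Am => //; exact: ymax.
Qed.

(** T has height at most 1, and its non-Hausdorff suspension with apexes a and b
    is contractible, so it has a beat point. If an apex is one, T has a maximum
    and the union is a single A y. An up beat point x of T can be dropped, as
    A x is contained in the member above it. A down beat point x is maximal in
    T by the bound on the height, and A x meets the rest of the union in A y,
    where y is the only point below x: the union theorem applies. The apexes
    are kept along the induction so that a maximal point of T below both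
    of them is never an up beat point. *)
Lemma absolute_extensor_carrier X (T : {set X}) (A : X -> {set {set V}})
    (a b : X) :
  a != b -> ~~ (a <= b)%O -> ~~ (b <= a)%O ->
  (forall z, z \in T -> (z < a)%O && (z < b)%O) ->
  (forall x y z, x \in T -> y \in T -> z \in T ->
    (x < y)%O -> (y < z)%O -> False) ->
  fence_contractible (T :|: [set a; b])%SET -> carrier T A ->
  absolute_extensor (poly (\bigcup_(z in T) A z)%SET).
Proof.
move=> ab nab nba.
have [n] := ubnP #|T|; elim: n T => // n IH T ltn Tab Th cT carT.
have aD : a \in (T :|: [set a; b])%SET by rewrite !finset.inE eqxx ?orbT.
have bD : b \in (T :|: [set a; b])%SET by rewrite !finset.inE eqxx ?orbT.
have DT x : x \in (T :|: [set a; b])%SET -> (x < a)%O || (x < b)%O -> x \in T.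
  rewrite !finset.inE => /orP[//|/orP[]/eqP ->]; rewrite ltxx /= ?orbF.
    by move=> /ltW h; rewrite h in nab.
  by move=> /ltW h; rewrite h in nba.
have aT : a \notin T by apply: contraT => /negPn /Tab; rewrite ltxx.
have bT : b \notin T by apply: contraT => /negPn /Tab; rewrite ltxx andbF.
have topT y : (forall z, z \in T -> (z <= y)%O) -> y \in T ->
    absolute_extensor (poly (\bigcup_(z in T) A z)%SET).
  move=> ymax yT; rewrite (carrier_max carT yT ymax).
  by case: carT => _ + _ _; exact.
have [hA aeA Am Ai] := carT.
have [x xD beat] := beat_point_exists cT aD bD ab.
have := xD; rewrite finset.in_setU finset.in_set2 => /orP[xT|xab]; last first.
  case: beat => [h|[y yD [yx h]]].
    case: h => y yD [xy _]; move: yD; rewrite !finset.inE => yD; exfalso.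
    case/orP: xab => /eqP xE; rewrite xE in xy;
      case/orP: yD => [yT|/orP[]/eqP yE].
    - have /andP[ya _] := Tab _ yT.
      by have := lt_trans xy ya; rewrite ltxx.
    - by rewrite yE ltxx in xy.
    - by rewrite yE in xy; rewrite (ltW xy) in nab.
    - have /andP[_ yb] := Tab _ yT.
      by have := lt_trans xy yb; rewrite ltxx.
    - by rewrite yE in xy; rewrite (ltW xy) in nba.
    - by rewrite yE ltxx in xy.
  apply: (topT y).
    move=> z zT; apply: h; first by rewrite finset.inE zT.
    by have /andP[za zb] := Tab z zT; case/orP: xab => /eqP->.
  by apply: DT => //; case/orP: xab => /eqP <-; rewrite yx ?orbT.
have TxE : ((T :|: [set a; b]) :\ x = (T :\ x) :|: [set a; b])%SET.
  apply/setP => z; rewrite !finset.inE; case: eqVneq => //= ->.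
  apply/esym/negbTE/norP.
  by split; apply/eqP => xE; [move: aT|move: bT]; rewrite -xE xT.
(* Dropping x keeps the intersection property if x can be replaced as a common
   lower bound. *)
have carx : (forall y, y \in T -> y != x -> forall z, z \in T -> z != x ->
    (x <= y)%O -> (x <= z)%O -> exists w,
      [/\ w \in T, w != x, (w <= y)%O, (w <= z)%O & A x \subset A w]) ->
    carrier (T :\ x)%SET A.
  move=> hx; split.
  - by move=> z; rewrite !finset.inE => /andP[_]; exact: hA.
  - by move=> z; rewrite !finset.inE => /andP[_]; exact: aeA.
  - by move=> y z; rewrite !finset.inE => /andP[_ yT] /andP[_ zT]; exact: Am.
  - move=> y z t; rewrite !finset.inE => /andP[yx yT] /andP[zx zT] ty tz.
    have [w [wT wy wz tw]] := Ai y z t yT zT ty tz.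
    have [wx|wx] := eqVneq w x; last by exists w; rewrite !finset.inE wx.
    have [||w' [w'T w'x w'y w'z Aw]] := hx y yT yx z zT zx.
    + by rewrite -wx.
    + by rewrite -wx.
    exists w'; rewrite !finset.inE w'x; split=> //.
    by apply: (fintype.subsetP Aw); rewrite -wx.
have IHx : carrier (T :\ x)%SET A ->
    absolute_extensor (poly (\bigcup_(z in T :\ x) A z)%SET).
  apply: IH.
  - by move: ltn; rewrite (cardsD1 x T) xT.
  - by move=> z; rewrite !finset.inE => /andP[_]; exact: Tab.
  - move=> u v w; rewrite !finset.inE => /andP[_ uT] /andP[_ vT] /andP[_ wT].
    exact: Th.
  - by rewrite -TxE; exact: fence_contractible_beat.
have UE : (\bigcup_(z in T) A z = A x :|: \bigcup_(z in T :\ x) A z)%SET.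
  by rewrite (big_setD1 x).
have /andP[xa xb] := Tab x xT.
case: beat => -[y yD [yx h]].
  have yT : y \in T.
    move: yD; rewrite !finset.inE => /orP[//|/orP[]/eqP yE].
      by have := h b bD xb; rewrite yE (negPf nab).
    by have := h a aD xa; rewrite yE (negPf nba).
  have yTx : y \in (T :\ x)%SET by rewrite !finset.inE yT gt_eqF.
  rewrite UE (finset.setUidPr _).
    apply: IHx; apply: carx => u uT ux v vT vx xu xv.
    exists y; split=> //.
    - by rewrite gt_eqF.
    - by apply: h; rewrite ?finset.inE ?uT// lt_neqAle eq_sym ux.
    - by apply: h; rewrite ?finset.inE ?vT// lt_neqAle eq_sym vx.
    - by apply: Am => //; exact: ltW.
  apply: (fintype.subset_trans (Am x y xT yT (ltW yx))).
  exact: (finset.bigcup_sup y).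
have yT : y \in T by apply: DT => //; rewrite (lt_trans yx xa).
(* Otherwise y < x < z would be a chain of T. *)
have xmax z : z \in T -> (x <= z)%O -> z = x.
  move=> zT xz; apply/eqP; apply: contraT => zx; exfalso.
  by apply: (Th y x z yT xT zT yx); rewrite lt_neqAle eq_sym zx.
rewrite UE; apply: absolute_extensor_polyhedronU; first exact: hA.
- apply: simplicial_complex_bigcup => z.
  by rewrite !finset.inE => /andP[_]; exact: hA.
- exact: aeA.
- apply: IHx; apply: carx => u uT ux v vT vx xu.
  by rewrite (xmax u uT xu) eqxx in ux.
rewrite (_ : _ :&: _ = A y)%SET; first exact: aeA.
apply/setP => t; rewrite finset.inE.
apply/andP/idP => [[tx /finset.bigcupP[z]]|ty].
  rewrite !finset.inE => /andP[zx zT] tz.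
  have [w [wT wx wz tw]] := Ai x z t xT zT tx tz.
  have [wE|wx'] := eqVneq w x.
    by rewrite wE in wz; rewrite (xmax z zT wz) eqxx in zx.
  have wy : (w <= y)%O.
    by apply: h; rewrite ?finset.inE ?wT// lt_neqAle wx'.
  exact: (fintype.subsetP (Am w y wT yT wy)).
split; first exact: (fintype.subsetP (Am y x yT xT (ltW yx))).
by apply/finset.bigcupP; exists y => //; rewrite !finset.inE yT lt_eqF.
Qed.

End Carriers.

(** * Following qc-reductions *)

Section QuasiConstructible.
Variables (R : realType) (V : finType).
Implicit Types (s t : {set V}).

Local Notation poly K := (@polyhedron V R K).

Section Poset.
Context {d : Order.disp_t}.
Implicit Types (X : finPOrderType d).

Local Notation inT := (finset.in_setT _).

Lemma chain4_height X (x y z a : X) :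
  (x < y)%O -> (y < z)%O -> (z < a)%O -> (3 <= height X)%N.
Proof.
move=> xy yz za.
have [xz ya] := (lt_trans xy yz, lt_trans yz za).
have xa := lt_trans xy ya.
pose C := [set u in [:: x; y; z; a]]%SET.
have cC : chain C.
  apply/forall_inP => u uC; apply/forall_inP => v; move: uC.
  rewrite !finset.inE => /or4P[] /eqP -> /or4P[] /eqP ->;
    by rewrite /Order.comparable ?lexx ?(ltW xy) ?(ltW yz) ?(ltW za) ?(ltW xz)
      ?(ltW ya) ?(ltW xa) ?orbT.
have cardC : #|C| = 4%N.
  rewrite cardsE; apply/card_uniqP; rewrite /= !inE !negb_or.
  rewrite (lt_eqF xy) (lt_eqF xz) (lt_eqF xa).
  by rewrite (lt_eqF yz) (lt_eqF ya) (lt_eqF za).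
by rewrite /height (bigD1 C)//= cardC leq_max.
Qed.

(** The points below a and b form a poset of height at most 1: a chain of three of
    them would continue to a and have length 3. *)
Lemma absolute_extensor_carrierI X (A : X -> {set {set V}}) (a b : X) :
  height X = 2%N -> a != b -> maximal_point a -> maximal_point b ->
  contractible R (set_type (minimal_open a `|` minimal_open b)) ->
  carrier R [set: X]%SET A ->
  absolute_extensor (poly (A a :&: A b)).
Proof.
move=> hX ab ma mb cab [hA aeA Am Ai].
have nab : ~~ (a <= b)%O by apply: contra ab => /ma ->.
have nba : ~~ (b <= a)%O by apply: contra ab => /mb ->.
pose T := [set x | (x <= a)%O && (x <= b)%O]%SET.
have Tab x : x \in T -> (x < a)%O && (x < b)%O.
  rewrite finset.inE => /andP[xa xb]; rewrite !lt_neqAle xa xb !andbT.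
  by apply/andP; split; [apply: contraNneq nab => <-|apply: contraNneq nba => <-].
have carT : carrier R T A.
  split.
  - by move=> z _; exact: hA.
  - by move=> z _; exact: aeA.
  - by move=> y z _ _; exact: Am.
  - move=> y z t; rewrite !finset.inE => /andP[ya yb] _ ty tz.
    have [w [_ wy wz tw]] := Ai y z t inT inT ty tz.
    by exists w; split=> //; rewrite finset.inE (le_trans wy ya) (le_trans wy yb).
have -> : (A a :&: A b = \bigcup_(z in T) A z)%SET.
  apply/setP => t; rewrite finset.inE; apply/andP/finset.bigcupP.
    move=> [ta tb].
    have [w [_ wa wb tw]] := Ai a b t inT inT ta tb.
    by exists w; rewrite // finset.inE wa.
  move=> [z]; rewrite finset.inE => /andP[za zb] tz.
  by split; [apply: (fintype.subsetP (Am z a _ _ za))|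
    apply: (fintype.subsetP (Am z b _ _ zb))].
apply: (absolute_extensor_carrier ab nab nba Tab _ _ carT).
  move=> x y z xT yT zT xy yz; have /andP[za _] := Tab z zT.
  by have := chain4_height xy yz za; rewrite hX.
apply: fence_contractible_lowerI => //.
apply: fence_contractible_of_contractible cab => x.
by rewrite finset.inE; split=> [[]/= ->//|/orP[]]; rewrite ?orbT//; [left|right].
Qed.

(** What is preserved along a sequence of qc-reductions. As a point with sigma in
    its subcomplex is maximal, and two maximal points share only subcomplexes
    of points below both, there is at most one such point. *)
Definition qc_invariant X (C : {set {set V}}) sigma (A : X -> {set {set V}}) :=
  carrier R [set: X]%SET A /\
  forall y, sigma \in A y -> [/\ maximal_point y,
    simplicial_complex (A y :\ sigma)%SET & deforms_into R C (A y :\ sigma)%SET].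

Definition merge_carrier X (A : X -> {set {set V}}) (a b : X)
    (u : qc_merge a b) : {set {set V}} :=
  if u is Some x then A (val x) else A a :|: A b.

(** The triangle is not in A b, so removing it affects A a only, and A b is glued
    to A a :\ sigma along the same intersection A a :&: A b. *)
Lemma deforms_into_merge X C sigma (A : X -> {set {set V}}) (a b : X) :
  a != b -> qc_invariant C sigma A -> absolute_extensor (poly (A a :&: A b)) ->
  sigma \in A a ->
  simplicial_complex ((A a :|: A b) :\ sigma)%SET /\
  deforms_into R C ((A a :|: A b) :\ sigma)%SET.
Proof.
move=> ab [[hA aeA Am Ai] inv] aeI sa.
have [ma ca da] := inv a sa.
have sb : sigma \notin A b.
  apply/negP => sb; have [w [_ wa wb sw]] := Ai a b sigma inT inT sa sb.
  have [mw _ _] := inv w sw.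
  by case/eqP: ab; rewrite (mw a wa) (mw b wb).
have -> : ((A a :|: A b) :\ sigma = (A a :\ sigma) :|: A b)%SET.
  apply/setP => t; rewrite !finset.inE; case: eqVneq => //= ->.
  by rewrite (negPf sb).
split; first by apply: simplicial_complexU => //; exact: hA.
apply: deforms_intoU => //; [exact: hA|exact: aeA|].
rewrite (_ : _ :&: _ = A a :&: A b)%SET//.
apply/setP => t; rewrite !finset.inE; case: eqVneq => //= ->.
by rewrite (negPf sb) andbF.
Qed.

(** A common lower bound given by the family A is never a or b: these are maximal,
    so they lie below no other point of the poset. *)
Lemma qc_invariant_merge X C sigma (A : X -> {set {set V}}) (a b : X) :
  height X = 2%N -> a != b -> maximal_point a -> maximal_point b ->
  contractible R (set_type (minimal_open a `|` minimal_open b)) ->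
  qc_invariant C sigma A -> qc_invariant C sigma (@merge_carrier X A a b).
Proof.
move=> hX ab ma mb cab inv.
have aeI := absolute_extensor_carrierI hX ab ma mb cab inv.1.
have [[hA aeA Am Ai] invs] := inv.
have neq (u : {x : X | (x != a) && (x != b)}) : val u != a /\ val u != b.
  by apply/andP; exact: (valP u).
have hab : simplicial_complex (A a :|: A b).
  by apply: simplicial_complexU; exact: hA.
split.
  split.
  - by move=> [u|] _; [exact: hA|exact: hab].
  - move=> [u|] _; first exact: aeA.
    by apply: absolute_extensor_polyhedronU => //;
      [exact: hA|exact: hA|exact: aeA|exact: aeA].
  - move=> [y|] [z|] _ _ //; rewrite /Order.le /=; first exact: Am.
    case/orP => yab; apply: (fintype.subset_trans (Am _ _ inT inT yab)).
      exact: finset.subsetUl.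
    exact: finset.subsetUr.
  - pose common u t := exists w : qc_merge a b,
      [/\ w \in [set: qc_merge a b]%SET, (w <= (Some u : qc_merge a b))%O,
        (w <= (None : qc_merge a b))%O & t \in merge_carrier A w].
    have mix (u : {x : X | (x != a) && (x != b)}) t : t \in A (val u) ->
        t \in A a :|: A b -> common u t.
      have [ua ub] := neq u.
      have mk c : t \in A (val u) -> t \in A c -> (c == a) || (c == b) ->
          common u t.
        move=> tu tc cab'.
        have [w [_ wu wc tw]] := Ai (val u) c t inT inT tu tc.
        have wa : w != a.
          by apply: contraNneq ua => wa; apply/eqP/ma; move: wu; rewrite wa.
        have wb : w != b.
          by apply: contraNneq ub => wb; apply/eqP/mb; move: wu; rewrite wb.
        have wab : (w != a) && (w != b) by rewrite wa.
        exists (Some (exist _ w wab)); split=> //; first exact: finset.in_setT.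
        by rewrite /Order.le /=; case/orP: cab' wc => /eqP -> ->; rewrite ?orbT.
      move=> tu; rewrite finset.inE => /orP[ta|tb].
        by apply: (mk a) => //; rewrite eqxx.
      by apply: (mk b) => //; rewrite eqxx orbT.
    move=> [y|] [z|] t _ _ /= ty tz.
    + have [w [_ wy wz tw]] := Ai _ _ t inT inT ty tz.
      have wab : (w != a) && (w != b).
        have [ya yb] := neq y; apply/andP; split.
          by apply: contraNneq ya => wa; apply/eqP/ma; move: wy; rewrite wa.
        by apply: contraNneq yb => wb; apply/eqP/mb; move: wy; rewrite wb.
      by exists (Some (exist _ w wab)); split=> //; exact: finset.in_setT.
    + exact: mix.
    + by have [w [wT w1 w2 tw]] := mix z t tz ty; exists w.
    + by exists None; split=> //; exact: finset.in_setT.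
move=> [y|] /= sy.
  have [my cy dy] := invs _ sy; split=> //.
  move=> [x|]; rewrite /Order.le /=.
    by move=> /my xy; congr Some; exact: val_inj.
  have [ya yb] := neq y.
  by case/orP => /my h; [case/eqP: ya|case/eqP: yb]; exact: esym h.
have [cm dm] : simplicial_complex ((A a :|: A b) :\ sigma)%SET /\
    deforms_into R C ((A a :|: A b) :\ sigma)%SET.
  move: sy; rewrite finset.inE => /orP[sa|sb].
    exact: deforms_into_merge.
  rewrite finset.setUC; apply: deforms_into_merge => //; first by rewrite eq_sym.
  by rewrite finset.setIC.
by split=> // -[x|]; rewrite /Order.le.
Qed.

(** The union of the subcomplexes does not change along the reductions, and a
    maximum carries the whole of it. *)
Lemma qc_deforms_into X Y C sigma :
  clos_refl_trans_1n _ (@qc_reduction R d) X Y -> has_maximum Y ->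
  forall A : X -> {set {set V}}, qc_invariant C sigma A ->
  (exists x, sigma \in A x) ->
  deforms_into R C ((\bigcup_(x in [set: X]) A x) :\ sigma)%SET.
Proof.
elim=> {X Y} [X|X _ Y [a b hX ab ma mb cab] _ IH] mY A inv [x sx].
  have [m mm] := mY; have [car invs] := inv; have [_ _ Am _] := car.
  rewrite (carrier_max car (finset.in_setT m)) => [|z _]; last exact: mm.
  have sm : sigma \in A m by apply: (fintype.subsetP (Am x m _ _ (mm x))).
  by case: (invs m sm).
have := IH mY _ (qc_invariant_merge hX ab ma mb cab inv).
have UE : (\bigcup_(u in [set: qc_merge a b]) merge_carrier A u =
    \bigcup_(x in [set: X]) A x)%SET.
  apply/setP => t; apply/finset.bigcupP/finset.bigcupP => [[[u|] _ /=]|[y _ ty]].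
  - by exists (val u).
  - by rewrite finset.inE => /orP[] ?; [exists a|exists b].
  - have [ya|ya] := eqVneq y a.
      by exists None; rewrite ?finset.in_setT//= finset.inE -ya ty.
    have [yb|yb] := eqVneq y b.
      by exists None; rewrite ?finset.in_setT//= finset.inE -yb ty orbT.
    have yab : (y != a) && (y != b) by rewrite ya.
    by exists (Some (exist _ y yab)); rewrite ?finset.in_setT.
rewrite UE; apply.
have : sigma \in (\bigcup_(u in [set: qc_merge a b]) merge_carrier A u)%SET.
  by rewrite UE; apply/finset.bigcupP; exists x.
by case/finset.bigcupP => u _ su; exists u.
Qed.

End Poset.

End QuasiConstructible.

Section FacePoset.
Variables (R : realType) (V : finType) (L : {set {set V}}) (sigma : {set V}).
Hypotheses (hL : simplicial_complex L) (hdim : dimension L = 2%N).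
Hypotheses (hsigma : sigma \in L) (hsigma2 : #|sigma| = 3%N).

Let X := face_poset L.
Let A (s : X) : {set {set V}} := simplex (val s).

Lemma top_simplex_maximal s : s \in L -> sigma \subset s -> s = sigma.
Proof.
move=> sL ss; apply/esym/eqP; rewrite eqEcard ss hsigma2.
have : (#|s|.-1 <= dimension L)%N.
  by rewrite /dimension (bigD1 s)//= leq_max leqnn.
by rewrite hdim; case: #|s|.
Qed.

Lemma simplicial_complex_boundary :
  simplicial_complex (simplex sigma :\ sigma)%SET.
Proof.
have [n0 down] := simplicial_complex_simplex sigma.
split; first by rewrite finset.inE (negPf n0) andbF.
move=> s t; rewrite !finset.inE => /and3P[ssig s0 ss] ts t0.
rewrite t0 (fintype.subset_trans ts ss) !andbT.
apply: contraNneq ssig => tE; rewrite finset.eqEsubset ss -tE; exact: ts.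
Qed.

Lemma face_poset_invariant :
  qc_invariant R (simplex sigma :\ sigma)%SET sigma A.
Proof.
have [n0 down] := hL.
have val0 (s : X) : val s != finset.set0.
  by apply: contraNneq n0 => <-; exact: (valP s).
split.
  split.
  - by move=> z _; exact: simplicial_complex_simplex.
  - by move=> z _; exact: absolute_extensor_simplex.
  - move=> y z _ _ yz; apply/fintype.subsetP => t; rewrite !finset.inE.
    by move=> /andP[-> ty]; exact: fintype.subset_trans ty yz.
  - move=> y z t _ _; rewrite !finset.inE => /andP[t0 ty] /andP[_ tz].
    have tL : t \in L by apply: down ty t0; exact: (valP y).
    exists (exist _ t tL : X); split; rewrite ?finset.in_setT//.
    by rewrite finset.inE t0 subxx.
move=> y; rewrite finset.inE => /andP[_ sy].
have yE : val y = sigma by apply: top_simplex_maximal => //; exact: (valP y).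
split.
- move=> x yx; apply: val_inj; rewrite yE; apply: top_simplex_maximal.
    exact: (valP x).
  by rewrite -yE; exact: yx.
- by rewrite /A yE; exact: simplicial_complex_boundary.
- by rewrite /A yE; exact: deforms_into_refl.
Qed.

Lemma deforms_into_boundary : contractible_quasi_constructible R L ->
  deforms_into R (simplex sigma :\ sigma)%SET (L :\ sigma)%SET.
Proof.
move=> [_ [Y [XY mY]]]; have [n0 down] := hL.
have s0 : sigma != finset.set0 by rewrite -card_gt0 hsigma2.
have := qc_deforms_into XY mY face_poset_invariant.
rewrite (_ : (\bigcup_(x in [set: X]) A x)%SET = L).
  apply; exists (exist _ sigma hsigma : X).
  by rewrite finset.inE s0 subxx.
apply/setP => t; apply/finset.bigcupP/idP => [[x _]|tL].
  by rewrite finset.inE => /andP[t0 tx]; apply: down tx t0; exact: (valP x).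
exists (exist _ t tL : X); first exact: finset.in_setT.
by rewrite finset.inE subxx andbT; apply: contraNneq n0 => <-.
Qed.

End FacePoset.

(** * Angles and their lifts *)

Section Polar.
Variable R : realType.
Implicit Types a b t r : R.

(** The angle t of the nonzero vector (a, b) of the plane. *)
Definition polar a b t := exists2 r, 0 < r & a = r * cos t /\ b = r * sin t.

Lemma polar_exists a b : a ^+ 2 + b ^+ 2 != 0 -> exists t, polar a b t.
Proof.
move=> ab0.
have n0 : 0 < a ^+ 2 + b ^+ 2.
  by rewrite lt_neqAle eq_sym ab0 addr_ge0 ?sqr_ge0.
set n := Num.sqrt (a ^+ 2 + b ^+ 2).
have np : 0 < n by rewrite sqrtr_gt0.
have n2 : n ^+ 2 = a ^+ 2 + b ^+ 2 by rewrite sqr_sqrtr// ltW.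
have an : -1 <= a / n <= 1.
  rewrite -ler_norml normrM normfV (gtr0_norm np) ler_pdivrMr// mul1r.
  by rewrite -sqrtr_sqr ler_wsqrtr// lerDl sqr_ge0.
have ca : n * cos (acos (a / n)) = a.
  by rewrite acosK ?in_itv//= mulrCA divff ?gt_eqF// mulr1.
have sa : n * sin (acos (a / n)) = `|b|.
  rewrite sin_acos//.
  have -> : 1 - (a / n) ^+ 2 = (b / n) ^+ 2.
    rewrite !expr_div_n -[1](@divff _ (n ^+ 2)) ?expf_neq0 ?gt_eqF//.
    by rewrite -mulrBl n2 addrAC subrr add0r.
  rewrite sqrtr_sqr normrM normfV (gtr0_norm np) mulrCA divff ?gt_eqF//.
  by rewrite mulr1.
have [b0|b0] := leP 0 b.
  by exists (acos (a / n)), n => //; rewrite ca sa ger0_norm.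
exists (- acos (a / n)), n => //.
by rewrite cosN sinN ca mulrN sa ltr0_norm// opprK.
Qed.

(** Two vectors with positive scalar product make an angle between -pi/2 and
    pi/2, whose tangent is the quotient of their determinant by their scalar
    product. This choice of the increment is continuous in both vectors. *)
Lemma polar_turn a b a' b' t : polar a b t -> 0 < a * a' + b * b' ->
  polar a' b' (t + atan ((a * b' - b * a') / (a * a' + b * b'))).
Proof.
move=> [r r0 [aE bE]]; set dot := _ + _; set cr := _ - _ => dot0.
set x := cr / dot; set k := cos (atan x).
have k0 : 0 < k by rewrite /k cos_atan invr_gt0 sqrtr_gt0 ltr_wpDr ?sqr_ge0.
have sk : sin (atan x) = k * x.
  have /(congr1 ( *%R k)) := atanK x.
  by rewrite /tan mulrCA divff ?gt_eqF// mulr1.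
exists (dot / (r * k)); first by rewrite divr_gt0 ?mulr_gt0.
have rk : r * k != 0 by rewrite mulf_neq0 ?gt_eqF.
have d0 : dot != 0 by rewrite gt_eqF.
rewrite cosD sinD sk -/k.
have cs := cos2Dsin2 t.
have E1 : dot * (cos t - sin t * x) = r * a'.
  rewrite mulrBr mulrCA [dot * x]mulrC divfK// /dot /cr aE bE.
  rewrite -[r * a']mul1r -cs; ring.
have E2 : dot * (sin t + cos t * x) = r * b'.
  rewrite mulrDr [dot * (cos t * x)]mulrCA [dot * x]mulrC divfK//.
  rewrite /dot /cr aE bE.
  rewrite -[r * b']mul1r -cs; ring.
split.
  have -> : dot / (r * k) * (cos t * k - sin t * (k * x)) =
      dot * (cos t - sin t * x) * k / (r * k) by ring.
  by rewrite E1 [r * a' * k]mulrAC [r * k * a']mulrC mulfK.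
have -> : dot / (r * k) * (sin t * k + cos t * (k * x)) =
    dot * (sin t + cos t * x) * k / (r * k) by ring.
by rewrite E2 [r * b' * k]mulrAC [r * k * b']mulrC mulfK.
Qed.

(** If g 0 and g s differed, g would by the intermediate value theorem take a value
    at a distance in ]0, pi] from g 0, where the cosine of the difference is
    not 1. *)
Lemma continuous_angle_const (g : R -> R) (s : R) : continuous g -> 0 <= s ->
  (forall u, cos (g u) = cos (g 0) /\ sin (g u) = sin (g 0)) -> g s = g 0.
Proof.
move=> cg s0 gE; apply/eqP; apply: contraT => /eqP gs; exfalso.
have gD v : Num.min (g 0) (g s) <= v <= Num.max (g 0) (g s) ->
    cos (v - g 0) = 1.
  move=> gv; have [|u _ <-] := @IVT _ g 0 s v s0 _ gv.
    exact: continuous_subspaceT.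
  by rewrite cosB; case: (gE u) => -> ->; rewrite -!expr2 cos2Dsin2.
pose e := Num.min `|g s - g 0| pi.
have e0 : 0 < e.
  by rewrite lt_min pi_gt0 andbT normr_gt0 subr_eq0; apply/eqP.
have ce : cos e = 1.
  have [h|h] := leP (g 0) (g s).
    have := gD (g 0 + e); rewrite addrAC subrr add0r; apply.
    rewrite min_l// max_r// lerDl ltW//= -lerBrDl ge_min ger0_norm ?subr_ge0//.
    by rewrite lexx.
  have := gD (g 0 - e); rewrite addrAC subrr add0r cosN; apply.
  rewrite min_r ?max_l ?(ltW h)// lerBlDr lerDl (ltW e0) andbT.
  rewrite lerBrDr -lerBrDl ge_min ltr0_norm ?subr_lt0// opprB.
  by rewrite lexx.
have /eqP : e = 0.
  apply: cos_inj; rewrite ?ce ?cos0// in_itv/=.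
    by rewrite ltW//= ge_min lexx orbT.
  by rewrite lexx pi_ge0.
by rewrite gt_eqF.
Qed.

End Polar.

Section Cube.
Variables (R : realType) (n : nat).
Implicit Types u : 'rV[R]_n.

Lemma cts_row (T : topologicalType) (f : T -> 'rV[R]_n) (x : T) :
  (forall i, continuous_at x (fun y => f y ord0 i)) -> continuous_at x f.
Proof.
move=> cf A [P nP PA].
have : \forall y \near x, forall i, P ord0 i (f y ord0 i).
  apply: (@filter_forall _ _ (fun i y => P ord0 i (f y ord0 i)) (nbhs x) _) => i.
  by apply: (cf i); exact: nP.
by apply: filterS => y Py; apply: PA => i j; rewrite (ord1 i).
Qed.

Lemma cts_scale (T : topologicalType) (k : T -> R) (f : T -> 'rV[R]_n) (x : T) :
  continuous_at x k -> continuous_at x f ->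
  continuous_at x (fun y => k y *: f y).
Proof.
move=> ck cf; apply: cts_row => i.
have -> : (fun y => (k y *: f y) ord0 i) = fun y => k y * f y ord0 i.
  by apply/funext => y; rewrite mxE.
apply: ctsM => //; apply: (@continuous_comp _ _ _ f (fun u => u ord0 i)) => //.
exact: coord_continuous.
Qed.

Definition clamp u : 'rV[R]_n := \row_i Num.max 0 (Num.min 1 (u ord0 i)).

Lemma clamp_continuous : continuous clamp.
Proof.
move=> u; apply: cts_row => i.
have -> : (fun y => clamp y ord0 i) =
    fun y : 'rV[R]_n => Num.max 0 (Num.min 1 (y ord0 i)).
  by apply/funext => y; rewrite mxE.
apply: cts_max; first exact: cts_cst.
apply: cts_min; first exact: cts_cst.
exact: coord_continuous.
Qed.

Lemma clamp_cube u : cube (clamp u).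
Proof.
move=> i; rewrite mxE le_max lexx /= ge_max ler01 /=.
by rewrite ge_min lexx.
Qed.

Lemma clamp_id u : cube u -> clamp u = u.
Proof.
move=> cu; apply/rowP => i; rewrite mxE.
by have /andP[u0 u1] := cu i; rewrite min_r// max_r.
Qed.

Lemma cube_compact : compact (@cube R n).
Proof.
have := @rV_compact R n (fun=> `[0, 1]%classic) (fun=> @segment_compact R 0 1).
by rewrite set_itvE; apply.
Qed.

(** The cube is star-shaped at 0. By compactness, [0, 1] can be cut into so many
    pieces that, on every segment from 0 to u, consecutive values make an acute
    angle; the angle at u is the angle at 0 plus the sum of the increments along
    the segment. Clamping makes the result continuous on the whole space. *)
Lemma lift_polar (w0 w1 : 'rV[R]_n -> R) :
  continuous w0 -> continuous w1 ->
  (forall u, w0 u ^+ 2 + w1 u ^+ 2 != 0) ->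
  exists2 th : 'rV[R]_n -> R, continuous th &
    forall u, cube u -> polar (w0 u) (w1 u) (th u).
Proof.
move=> c0 c1 w0n.
pose dot u v := w0 u * w0 v + w1 u * w1 v.
pose cr u v := w0 u * w1 v - w1 u * w0 v.
pose K := @cube R n `*` [set s : R | 0 <= s <= 1].
have cK : compact K.
  apply: compact_setX; first exact: cube_compact.
  by have := @segment_compact R 0 1; rewrite set_itvE.
have cdot (T : topologicalType) (f g : T -> 'rV[R]_n) x : continuous_at x f ->
    continuous_at x g -> continuous_at x (fun y => dot (f y) (g y)).
  move=> cf cg; apply: ctsD; apply: ctsM; apply: continuous_comp => //;
    by [exact: c0|exact: c1].
have ccr (T : topologicalType) (f g : T -> 'rV[R]_n) x : continuous_at x f ->
    continuous_at x g -> continuous_at x (fun y => cr (f y) (g y)).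
  move=> cf cg; apply: ctsB; apply: ctsM; apply: continuous_comp => //;
    by [exact: c0|exact: c1].
have [N dotN] : exists N : nat, forall u s, cube u -> 0 <= s <= 1 ->
    0 < dot (s *: u) ((s + N.+1%:R^-1) *: u).
  have : \forall e \near (0 : R),
      K `<=` (fun x => 0 < dot (x.2 *: x.1) ((x.2 + e) *: x.1)).
    have nc := iffLR (compact_near_coveringP K) cK R (nbhs (0 : R))
      (fun e x => 0 < dot (x.2 *: x.1) ((x.2 + e) *: x.1)) _.
    apply: nc => -[u s] [/= cu s01].
    pose F (y : ('rV[R]_n * R) * R) :=
      dot (y.1.2 *: y.1.1) ((y.1.2 + y.2) *: y.1.1).
    have cF : continuous_at (u, s, 0) F.
      have c2 : continuous_at (u, s, 0) (fun y : ('rV[R]_n * R) * R => y.1.2).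
        apply: (@continuous_comp _ _ _ fst snd); first exact: cvg_fst.
        exact: cvg_snd.
      have c1' : continuous_at (u, s, 0) (fun y : ('rV[R]_n * R) * R => y.1.1).
        by apply: (@continuous_comp _ _ _ fst fst); exact: cvg_fst.
      apply: cdot; apply: cts_scale => //.
      by apply: ctsD => //; exact: cvg_snd.
    have F0 : 0 < F (u, s, 0).
      by rewrite /F /= addr0 lt_neqAle eq_sym /dot -!expr2 w0n addr_ge0 ?sqr_ge0.
    exact: (cF _ (lt_nbhsr F0)).
  move=> /(@cvg_harmonic R) [N _ HN]; exists N => u s cu s01.
  exact: (HN N (leqnn N) (u, s)).
have [t0 pt0] := polar_exists (w0n 0).
pose s k : R := k%:R / N.+1%:R.
have sS k : s k + N.+1%:R^-1 = s k.+1.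
  by rewrite /s -[k.+1]addn1 natrD mulrDl mul1r.
pose inc k u :=
  atan (cr (s k *: u) (s k.+1 *: u) / dot (s k *: u) (s k.+1 *: u)).
pose th k u := t0 + \sum_(i < k) inc i u.
have pth k u : cube u -> (k <= N.+1)%N ->
    polar (w0 (s k *: u)) (w1 (s k *: u)) (th k u).
  move=> cu; elim: k => [_|k IH kN].
    by rewrite /s mul0r scale0r /th big_ord0 addr0.
  rewrite /th big_ord_recr /= addrA; apply: polar_turn; first exact/IH/ltnW.
  have sk : 0 <= s k <= 1.
    by rewrite /s divr_ge0//= ler_pdivrMr// mul1r ler_nat ltnW.
  by have := dotN u (s k) cu sk; rewrite sS.
have sN : s N.+1 = 1 by rewrite /s divff.
exists (th N.+1 \o clamp); last first.
  move=> u cu; rewrite /= clamp_id//.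
  by have := pth N.+1 u cu (leqnn _); rewrite sN scale1r.
move=> u; rewrite /th /=.
apply: ctsD; first exact: cts_cst.
apply: cts_sum => -[i iN] _ /=; rewrite /inc.
apply: (@cts_comp _ _ _ _ (@atan R)); last exact: continuous_atan.
have csc k : continuous_at u (fun y => s k *: clamp y).
  by apply: cts_scale; [exact: cts_cst|exact: clamp_continuous].
apply: ctsM; first exact: ccr.
apply: ctsV; last exact: cdot.
have si : 0 <= s i <= 1.
  by rewrite /s divr_ge0//= ler_pdivrMr// mul1r ler_nat ltnW.
rewrite gt_eqF//.
by have := dotN (clamp u) (s i) (@clamp_cube u) si; rewrite sS.
Qed.

End Cube.

(** * The line as a covering of the boundary of a triangle *)

Section Boundary.
Variables (R : realType) (n : nat).

(** The segment from u to z stays in a face of the cube, where the angle th is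
    determined up to a multiple of 2 * pi. *)
Lemma cube_segment_const (th : 'rV[R]_n -> R) (u z : 'rV[R]_n) (i : 'I_n)
    (e : R) :
  continuous th ->
  (forall x y, cube_boundary x -> cube_boundary y ->
     cos (th x) = cos (th y) /\ sin (th x) = sin (th y)) ->
  cube u -> cube z -> e = 0 \/ e = 1 -> u ord0 i = e -> z ord0 i = e ->
  th z = th u.
Proof.
move=> cth thE cu cz e01 ui zi.
pose c s : R := Num.max 0 (Num.min 1 s).
have c01 s : 0 <= c s <= 1.
  by rewrite /c le_max lexx/= ge_max ler01 ge_min lexx.
pose q s := (1 - c s) *: u + c s *: z.
have qE s j : q s ord0 j = (1 - c s) * u ord0 j + c s * z ord0 j.
  by rewrite !mxE.
have cc : continuous c.
  move=> s; apply: cts_max; first exact: cts_cst.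
  by apply: cts_min; [exact: cts_cst|exact: cvg_id].
have cq : continuous q.
  move=> s; apply: cts_row => j.
  have -> : (fun y => q y ord0 j) =
      fun y => (1 - c y) * u ord0 j + c y * z ord0 j.
    by apply/funext => y; exact: qE.
  apply: ctsD; apply: ctsM => //; try exact: cts_cst; try exact: cc.
  by apply: ctsB; [exact: cts_cst|exact: cc].
have q0 : q 0 = u.
  rewrite /q (_ : c 0 = 0) ?subr0 ?scale1r ?scale0r ?addr0//.
  by rewrite /c min_r ?ler01// maxxx.
have q1 : q 1 = z.
  rewrite /q (_ : c 1 = 1) ?subrr ?scale1r ?scale0r ?add0r//.
  by rewrite /c minxx max_r ?ler01.
have qb s : cube_boundary (q s).
  have /andP[s0 s1] := c01 s; have s1' : 0 <= 1 - c s by rewrite subr_ge0.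
  split.
    move=> j; rewrite qE; have /andP[u0 u1] := cu j; have /andP[z0 z1] := cz j.
    by apply/andP; split; nra.
  exists i; rewrite qE ui zi -mulrDl subrK mul1r; exact: e01.
rewrite -q0 -q1.
apply: (@continuous_angle_const R (th \o q) 1) => //.
  by move=> s; apply: cts_comp; [exact: cq|exact: cth].
by move=> s; exact: thE.
Qed.

(** This is where n >= 2 enters. From u with i-th coordinate 0 or 1, setting
    another coordinate k to 0 stays in the i-th face, and from there the face
    of equation 0 for the coordinate k leads to the origin. *)
Lemma cube_boundary_const (th : 'rV[R]_n -> R) :
  (2 <= n)%N -> continuous th ->
  (forall x y, cube_boundary x -> cube_boundary y ->
     cos (th x) = cos (th y) /\ sin (th x) = sin (th y)) ->
  forall u, cube_boundary u -> th u = th 0.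
Proof.
move=> n2 cth thE u [cu [i ui]].
have [k ki] : exists k : 'I_n, k != i.
  have : (0 < #|[set~ i]%SET|)%N.
    by rewrite cardsC1 card_ord -ltnS prednK// ltnW.
  by case/card_gt0P => k; rewrite !finset.inE => ki; exists k.
pose z : 'rV[R]_n := \row_j (if j == k then 0 else u ord0 j).
have zk : z ord0 k = 0 by rewrite mxE eqxx.
have zi : z ord0 i = u ord0 i by rewrite mxE eq_sym (negPf ki).
have cz : cube z.
  by move=> j; rewrite mxE; case: ifP => _; [rewrite lexx ler01|exact: cu].
have c0 : cube (0 : 'rV[R]_n) by move=> j; rewrite mxE lexx ler01.
rewrite -(cube_segment_const cth thE cu cz ui erefl zi).
by apply: (cube_segment_const cth thE c0 cz (or_introl erefl) _ zk); rewrite mxE.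
Qed.

End Boundary.

Section Circle.
Variables (R : realType) (V : finType) (sigma : {set V}).
Hypothesis card_sigma : #|sigma| = 3%N.

Local Notation W := ({ptws V -> R}).
Local Notation bd := (@polyhedron V R (simplex sigma :\ sigma)%SET).

Lemma polar_uniq (a b t t' : R) : polar a b t -> polar a b t' ->
  cos t = cos t' /\ sin t = sin t'.
Proof.
move=> [r r0 [-> ->]] [r' r'0 [ca sa]].
have rr : r ^+ 2 = r' ^+ 2.
  rewrite -[r ^+ 2]mulr1 -(cos2Dsin2 t) -[RHS]mulr1 -(cos2Dsin2 t') !mulrDr.
  by rewrite -!exprMn ca sa.
have rE : r = r'.
  by apply/eqP; rewrite -(eqrXn2 (ltn0Sn 1) (ltW r0) (ltW r'0)) rr.
have r'n : r' != 0 by rewrite gt_eqF.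
by split; apply: (mulfI r'n); rewrite -{1}rE.
Qed.

(** p is the unit circle pushed radially onto the boundary of the triangle, in the
    plane of points with sum of coordinates 1 centred at the barycentre. It is
    parametrized by the first two coordinates (cos t, sin t), the third one
    being determined. A point of the boundary has smallest coordinate 0, that is
    -1/3 from the barycentre, which gives the scaling factor d. *)
Lemma boundary_cover : exists p : R -> W, [/\ continuous p,
  forall t, bd (p t),
  forall x, bd x -> exists t, p t = x &
  forall n (G : 'rV[R]_n -> W), continuous G -> (forall u, bd (G u)) ->
    exists th : 'rV[R]_n -> R, [/\ continuous th,
      forall u, cube u -> p (th u) = G u &
      (2 <= n)%N -> (forall u, cube_boundary u -> G u = G 0) ->
        forall u, cube_boundary u -> th u = th 0]].
Proof.
have [v0 [v1 [v2 [v01 v02 v12 sE]]]] : exists v0 v1 v2 : V,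
    [/\ v0 != v1, v0 != v2, v1 != v2 & sigma = [set v0; v1; v2]%SET].
  have : (0 < #|sigma|)%N by rewrite card_sigma.
  case/card_gt0P => v0 v0s.
  have s2 : #|(sigma :\ v0)%SET| = 2%N.
    by have := cardsD1 v0 sigma; rewrite v0s card_sigma => -[].
  have /cards2P [v1 [v2 [v12 sE]]] := introT eqP s2.
  have : v1 \in (sigma :\ v0)%SET by rewrite sE !finset.inE eqxx.
  have : v2 \in (sigma :\ v0)%SET by rewrite sE !finset.inE eqxx orbT.
  rewrite !finset.inE => /andP[v20 _] /andP[v10 _].
  exists v0, v1, v2; rewrite eq_sym v10 eq_sym v20; split=> //.
  by rewrite -(finset.setD1K v0s) sE finset.setUA.
pose m t : R := Num.min (cos t) (Num.min (sin t) (- cos t - sin t)).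
have m0 t : m t < 0.
  rewrite /m !gt_min; apply: contraT.
  rewrite !negb_or -!leNgt => /and3P[c0 s0 cs0].
  have := cos2Dsin2 t; have -> : cos t = 0 by apply/eqP; rewrite eq_le; lra.
  have -> : sin t = 0 by apply/eqP; rewrite eq_le; lra.
  by rewrite expr0n addr0 => /eqP; rewrite eq_sym oner_eq0.
pose d t := - 3 * m t.
have d0 t : 0 < d t by rewrite /d; have := m0 t; lra.
pose p t : W := fun v => if v == v0 then cos t / d t + 3^-1 else
  if v == v1 then sin t / d t + 3^-1 else
  if v == v2 then (- cos t - sin t) / d t + 3^-1 else 0.
have p0 t : p t v0 = cos t / d t + 3^-1 by rewrite /p eqxx.
have p1 t : p t v1 = sin t / d t + 3^-1 by rewrite /p eq_sym (negPf v01) eqxx.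
have p2 t : p t v2 = (- cos t - sin t) / d t + 3^-1.
  by rewrite /p eq_sym (negPf v02) eq_sym (negPf v12) eqxx.
have sumE (x : W) : (forall v, v \notin sigma -> x v = 0) ->
    \sum_v x v = x v0 + x v1 + x v2.
  move=> xs; rewrite (bigD1 v0)//= (bigD1 v1) 1?eq_sym//= (bigD1 v2)/=; last first.
    by rewrite eq_sym v02 eq_sym v12.
  rewrite big1 ?addr0 ?addrA// => v /andP[/andP[w0 w1] w2].
  by apply: xs; rewrite sE !finset.inE !negb_or w0 w1.
have bd_out (x : W) v : bd x -> v \notin sigma -> x v = 0.
  move=> [_ _]; rewrite !finset.inE => /and3P[_ _ /fintype.subsetP h] vs.
  by apply/eqP; have := contraNN (h v) vs; rewrite finset.inE negbK.
have bd_sum (x : W) : bd x -> x v0 + x v1 + x v2 = 1.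
  by move=> xb; rewrite -sumE; [case: xb|move=> v; exact: bd_out].
have bd_zero (x : W) : bd x -> [\/ x v0 = 0, x v1 = 0 | x v2 = 0].
  move=> [_ _]; rewrite !finset.inE => /and3P[xs _ xsub].
  have [h0|n0] := eqVneq (x v0) 0; first by constructor 1.
  have [h1|n1] := eqVneq (x v1) 0; first by constructor 2.
  have [h2|n2] := eqVneq (x v2) 0; first by constructor 3.
  case/eqP: xs; apply/eqP; rewrite finset.eqEsubset xsub sE.
  by apply/fintype.subsetP => v; rewrite !finset.inE => /orP[/orP[]|] /eqP->.
have bd_ge0 (x : W) v : bd x -> 0 <= x v by case=> + _ _; exact.
have pbd t : bd (p t).
  have dn : d t != 0 by rewrite gt_eqF.
  have di : 0 < (d t)^-1 by rewrite invr_gt0.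
  have md : m t / d t = - 3^-1.
    by rewrite /d invfM mulrCA divff ?mulr1 ?invrN// lt_eqF.
  have ge e : m t <= e -> 0 <= e / d t + 3^-1.
    by move=> me; rewrite -(opprK 3^-1) -md subr_ge0 ler_pM2r.
  have ps v : v \notin sigma -> p t v = 0.
    rewrite sE !finset.inE !negb_or.
    move=> /andP[/andP[/negPf w0 /negPf w1] /negPf w2].
    by rewrite /p w0 w1 w2.
  have s1 : \sum_v p t v = 1.
    rewrite sumE// p0 p1 p2; by field.
  split=> //.
    move=> v; rewrite /p; case: ifP => _.
      by apply: ge; rewrite /m ge_min lexx.
    case: ifP => _; first by apply: ge; rewrite /m !ge_min lexx orbT.
    by case: ifP => _ //; apply: ge; rewrite /m !ge_min lexx !orbT.
  rewrite !finset.inE; apply/and3P; split.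
  - have mz e : m t = e -> e / d t + 3^-1 = 0 by move=> <-; rewrite md addNr.
    have h : (p t v0 == 0) || (p t v1 == 0) || (p t v2 == 0).
      rewrite p0 p1 p2.
      have : [\/ m t = cos t, m t = sin t | m t = - cos t - sin t].
        rewrite /m; case: (leP (cos t)) => _; first by constructor 1.
        by case: (leP (sin t)) => _; [constructor 2|constructor 3].
      by case=> /mz ->; rewrite eqxx ?orbT.
    apply: contraL h => /eqP sS; rewrite !negb_or.
    have ss v : v \in sigma -> p t v != 0 by rewrite -sS finset.inE.
    by rewrite !ss// sE !finset.inE eqxx ?orbT.
  - apply: contraPneq s1 => s0; rewrite big1 => [|v _].
      by apply/eqP; rewrite eq_sym oner_eq0.
    by apply/eqP; have := finset.in_set0 v; rewrite -s0 finset.inE => /negbFE.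
  - by apply/fintype.subsetP => v; rewrite finset.inE; apply: contraNT => /ps ->.
have pE x t : bd x -> polar (x v0 - 3^-1) (x v1 - 3^-1) t -> p t = x.
  move=> xb [r r0 [e0 e1]].
  have xs := bd_sum _ xb; have x0 v : 0 <= x v by exact: bd_ge0.
  have e2 : x v2 - 3^-1 = r * (- cos t - sin t) by lra.
  have rm : r * m t = - 3^-1.
    apply/eqP; rewrite eq_le; apply/andP; split.
      have mc : m t <= cos t by rewrite /m ge_min lexx.
      have ms : m t <= sin t by rewrite /m !ge_min lexx orbT.
      have mcs : m t <= - cos t - sin t by rewrite /m !ge_min lexx !orbT.
      have H e : m t <= e -> r * m t <= r * e by rewrite ler_pM2l.
      by case: (bd_zero _ xb) => xz;
        [have := H _ mc|have := H _ ms|have := H _ mcs]; lra.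
    rewrite /m; case: (leP (cos t)) => _; first by have := x0 v0; lra.
    by case: (leP (sin t)) => _; [have := x0 v1|have := x0 v2]; lra.
  have dE : (d t)^-1 = r.
    apply: (mulfI (lt0r_neq0 (d0 t))); rewrite divff ?gt_eqF//.
    by rewrite /d mulrAC -mulrA rm; lra.
  apply/funext => v; have [vs|vs] := boolP (v \in sigma); last first.
    by rewrite (bd_out _ _ (pbd t) vs) (bd_out _ _ xb vs).
  move: vs; rewrite sE !finset.inE => /orP[/orP[]|] /eqP ->.
  - by rewrite p0 dE; lra.
  - by rewrite p1 dE; lra.
  - by rewrite p2 dE; lra.
have w0 (x : W) : bd x -> (x v0 - 3^-1) ^+ 2 + (x v1 - 3^-1) ^+ 2 != 0.
  move=> xb; rewrite paddr_eq0 ?sqr_ge0// !sqrf_eq0 !subr_eq0.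
  apply/negP => /andP[/eqP x0 /eqP x1]; have := bd_sum _ xb.
  by case: (bd_zero _ xb); lra.
have cm : continuous m.
  move=> t; apply: cts_min; first exact: continuous_cos.
  apply: cts_min; first exact: continuous_sin.
  apply: ctsB; last exact: continuous_sin.
  apply: (@cts_comp _ _ _ (@cos R) -%R); first exact: continuous_cos.
  exact: opp_continuous.
have cd : continuous (fun t => (d t)^-1).
  move=> t; apply: ctsV; first by rewrite gt_eqF.
  by apply: ctsM; [exact: cts_cst|exact: cm].
have cp : continuous p.
  apply/continuous_ptwsP => v t; rewrite /p.
  case: (v == v0).
    apply: ctsD; last exact: cts_cst.
    by apply: ctsM; [exact: continuous_cos|exact: cd].
  case: (v == v1).
    apply: ctsD; last exact: cts_cst.
    by apply: ctsM; [exact: continuous_sin|exact: cd].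
  case: (v == v2); last exact: cts_cst.
  apply: ctsD; last exact: cts_cst.
  apply: ctsM; last exact: cd.
  apply: ctsB; last exact: continuous_sin.
  apply: (@cts_comp _ _ _ (@cos R) -%R); first exact: continuous_cos.
  exact: opp_continuous.
exists p; split=> //.
  by move=> x xb; have [t xt] := polar_exists (w0 _ xb); exists t; exact: pE.
move=> n G cG Gb.
have cw v : continuous (fun u => G u v - 3^-1).
  by move=> u; apply: ctsB; [exact: (iffLR (continuous_ptwsP _) cG)|exact: cts_cst].
have [th cth thP] := lift_polar (cw v0) (cw v1) (fun u => w0 _ (Gb u)).
exists th; split=> //; first by move=> u cu; apply: pE => //; exact: thP.
move=> n2 Gc; apply: cube_boundary_const => // x y xb yb.
apply: polar_uniq (thP x _) _; first by case: xb.
by have := thP y yb.1; rewrite (Gc y yb) (Gc x xb).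
Qed.

End Circle.

(** * Filling the cylinder over a loop *)

Section BallFilling.
Variables (R : realType) (n : nat).
Local Notation Z := ('rV[R]_n * R)%type.
Implicit Types (z : Z) (a u : 'rV[R]_n).

Lemma norm_coord_le a i : `|a ord0 i| <= `|a|.
Proof.
rewrite [X in _ <= X]/Num.norm /= mx_normrE.
exact: (le_bigmax _ (fun k : 'I_1 * 'I_n => `|a k.1 k.2|) (ord0, i)).
Qed.

Lemma norm_le1 a : (forall i, `|a ord0 i| <= 1) -> `|a| <= 1.
Proof.
move=> a1; rewrite [X in X <= _]/Num.norm /= mx_normrE.
by apply: bigmax_le => // -[j i] _; rewrite (ord1 j).
Qed.

Lemma norm_attained a : a != 0 -> exists i, `|a ord0 i| = `|a|.
Proof.
move=> a0; have /mx_norm_neq0[[j i] /= e] : mx_norm a != 0.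
  by apply: contraNneq a0 => /mx_norm_eq0 ->.
by exists i; move: e; rewrite (ord1 j) => <-.
Qed.

Lemma norm_pair z : `|z| = Num.max `|z.1| `|z.2|.
Proof. by rewrite prod_normE. Qed.

Definition to_cube a : 'rV[R]_n := \row_i ((a ord0 i + 1) / 2).
Definition of_cube u : 'rV[R]_n := \row_i (2 * u ord0 i - 1).

Lemma of_cubeK : cancel of_cube to_cube.
Proof. by move=> u; apply/rowP => i; rewrite !mxE; lra. Qed.

Lemma to_cube_continuous : continuous to_cube.
Proof.
move=> a; apply: cts_row => i.
have -> : (fun y => to_cube y ord0 i) = fun y : 'rV[R]_n => (y ord0 i + 1) / 2.
  by apply/funext => y; rewrite mxE.
apply: ctsM; last exact: cts_cst.
by apply: ctsD; [exact: coord_continuous|exact: cts_cst].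
Qed.

Lemma of_cube_continuous : continuous of_cube.
Proof.
move=> a; apply: cts_row => i.
have -> : (fun y => of_cube y ord0 i) = fun y : 'rV[R]_n => 2 * y ord0 i - 1.
  by apply/funext => y; rewrite mxE.
apply: ctsB; last exact: cts_cst.
by apply: ctsM; [exact: cts_cst|exact: coord_continuous].
Qed.

Lemma to_cube_cube a : `|a| <= 1 -> cube (to_cube a).
Proof.
move=> a1 i; rewrite mxE.
have := le_trans (norm_coord_le a i) a1; rewrite ler_norml => /andP[? ?].
by apply/andP; split; lra.
Qed.

Lemma to_cube_boundary a : `|a| = 1 -> cube_boundary (to_cube a).
Proof.
move=> a1; split; first by apply: to_cube_cube; rewrite a1.
have [|i ai] := @norm_attained a; first by rewrite -normr_gt0 a1.
exists i; rewrite mxE; move: ai; rewrite a1.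
by case: (ger0P (a ord0 i)) => a0 ai; [right|left]; lra.
Qed.

Lemma of_cube_norm u : cube u -> `|of_cube u| <= 1.
Proof.
move=> cu; apply: norm_le1 => i; rewrite mxE ler_norml.
by have /andP[? ?] := cu i; apply/andP; split; lra.
Qed.

Lemma of_cube_norm1 u : cube_boundary u -> `|of_cube u| = 1.
Proof.
move=> [cu [i ui]]; apply/eqP; rewrite eq_le of_cube_norm//=.
apply: le_trans (norm_coord_le _ i); rewrite mxE.
by case: ui => ->; rewrite ?mulr0 ?sub0r ?normrN ?normr1// mulr1 ger0_norm; lra.
Qed.

(** The unit ball of the product is the box [-1, 1]^n * [-1, 1]: the three cases are
    its bottom, its sides and its top. *)
Lemma sphere_cases z : `|z| = 1 -> [\/ z.2 = -1, `|z.1| = 1 | z.2 = 1].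
Proof.
rewrite norm_pair; case: leP => _ e; last by constructor 2.
by move: e; case: (ger0P z.2) => _ e; [constructor 3|constructor 1; lra].
Qed.

End BallFilling.

Section Filling.
Variables (R : realType) (T : topologicalType) (S : set T) (n : nat).
Variables (h : T * R -> T) (p : R -> T).
Variables (F : 'rV[R]_n -> T) (th : 'rV[R]_n -> R).
Hypothesis n_gt0 : (0 < n)%N.
Hypotheses (ch : {within S `*` setT, continuous h})
  (hS : forall x t, S x -> S (h (x, t))) (h0 : forall x, S x -> h (x, 0) = x).
Hypotheses (cp : continuous p) (pS : forall t, S (p t)).
Hypotheses (cF : continuous F) (FS : forall u, S (F u))
  (Fb : forall u, cube_boundary u -> F u = F 0).
Hypotheses (cth : continuous th)
  (pth : forall u, cube u -> p (th u) = h (F u, 1))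
  (thb : forall u, cube_boundary u -> th u = th 0).

Local Notation Z := ('rV[R]_n * R)%type.

Let cube0 : cube_boundary (0 : 'rV[R]_n).
Proof.
split; first by move=> i; rewrite mxE lexx ler01.
by exists (Ordinal n_gt0); left; rewrite mxE.
Qed.

(* The values on the sphere: F on the bottom, the base point F 0 elsewhere. *)
Let phi (z : Z) : T := if z.2 <= -1 then F (to_cube z.1) else F 0.
(* On the inner ball, rescaled to the box: 2 *: z has last coordinate between
   -1 and 1, hence the parameter z.2 + 1/2 of the linear contraction. *)
Let Th (z : Z) : R :=
  (1 - (z.2 + 2^-1)) * th (to_cube (2 *: z.1)) + (z.2 + 2^-1) * th 0.
(* Radial projection of the outer shell to the sphere; the maximum only makes it
   continuous at the origin. *)
Let nu (z : Z) : Z :=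
  ((Num.max 2^-1 `|z|)^-1 *: z.1, (Num.max 2^-1 `|z|)^-1 * z.2).
Let Phi (z : Z) : T :=
  if `|z| <= 2^-1 then p (Th z) else h (phi (nu z), 2 - 2 * `|z|).

Let norm_cts (z : Z) : continuous_at z (fun y : Z => `|y|).
Proof. exact: norm_continuous. Qed.

Let nu_norm (z : Z) : 2^-1 <= `|z| -> `|nu z| = 1.
Proof.
move=> z2; have z0 : 0 < `|z| by apply: lt_le_trans z2; rewrite invr_gt0.
rewrite /nu max_r//.
have -> : (`|z|^-1 *: z.1, `|z|^-1 * z.2) = `|z|^-1 *: z by [].
by rewrite normrZ normfV normr_id mulVf// gt_eqF.
Qed.

Let cnu : continuous nu.
Proof.
move=> z.
have ci : continuous_at z (fun y : Z => (Num.max 2^-1 `|y|)^-1).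
  apply: ctsV; first by rewrite gt_eqF// lt_max invr_gt0 ltr0n.
  by apply: cts_max; [exact: cts_cst|exact: norm_cts].
apply: cts_pair.
  by apply: cts_scale => //; exact: cvg_fst.
by apply: ctsM => //; exact: cvg_snd.
Qed.

Let cphi : {within [set z : Z | `|z| = 1], continuous phi}.
Proof.
pose S0 := [set z : Z | `|z| = 1].
have cS0 : closed S0.
  apply: (@preimage_closed _ _ (fun z : Z => `|z|) [set t : R | t = 1]).
    by move=> z _; exact: norm_cts.
  exact: closed_eq.
pose S1 := S0 `&` [set z | z.2 <= -1].
pose S2 := S0 `&` ([set z | 1 <= `|z.1|] `|` [set z | 1 <= z.2]).
have csnd : continuous (fun z : Z => z.2) by move=> z; exact: cvg_snd.
have cS1 : closed S1.
  apply: (@closed_within_le R _ S0 (fun z => z.2)) => //.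
  exact: continuous_subspaceT.
have cn1 : continuous (fun z : Z => `|z.1|).
  by move=> z; apply: cts_comp; [exact: cvg_fst|exact: norm_continuous].
have cS2 : closed S2.
  rewrite /S2 setIUr; apply: closedU.
    apply: (@closed_within_ge R _ S0 (fun z => `|z.1|)) => //.
    exact: continuous_subspaceT.
  apply: (@closed_within_ge R _ S0 (fun z => z.2)) => //.
  exact: continuous_subspaceT.
apply: (@continuous_subspaceW _ _ _ (S1 `|` S2)).
  move=> z z1; case: (sphere_cases z1) => e.
  - by left; split=> //=; rewrite e.
  - by right; split=> //=; left; rewrite /= e.
  - by right; split=> //=; right; rewrite /= e.
apply: within_paste => //.
- apply: continuous_subspaceT => z; apply: cts_comp; last exact: cF.
  by apply: cts_comp; [exact: cvg_fst|exact: to_cube_continuous].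
- by apply: continuous_subspaceT => z; exact: cvg_cst.
- by move=> z [_ /= ->].
- move=> z [z1 [/= za|/= zs]] zs' _; last by exfalso; lra.
  apply: Fb; apply: to_cube_boundary; apply/eqP; rewrite eq_le za andbT -z1.
  by rewrite norm_pair le_max lexx.
- by move=> z [_ /= ->].
- by move=> z [z1 _] /= zs; split.
Qed.

Let phiS (z : Z) : S (phi z).
Proof. by rewrite /phi; case: ifP => _; exact: FS. Qed.

Let Phi_outer_inner (z : Z) :
  `|z| = 2^-1 -> p (Th z) = h (phi (nu z), 2 - 2 * `|z|).
Proof.
move=> zE; have nz : nu z = (2 *: z.1, 2 * z.2) by rewrite /nu zE maxxx invrK.
have n1 : `|nu z| = 1 by apply: nu_norm; rewrite zE.
have na : `|2 *: z.1| <= 1.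
  by rewrite -[leRHS]n1 nz norm_pair /= le_max lexx.
have cu := to_cube_cube na.
have hb : cube (0 : 'rV[R]_n) by case: cube0.
rewrite zE divff// (_ : 2 - 1 = 1)//; last by lra.
have := sphere_cases n1; rewrite nz /=.
have [zs _|zs] := leP (2 * z.2) (-1); rewrite /phi /= ?zs.
  have s1 : -1 <= 2 * z.2.
    have : `|2 * z.2| <= 1.
      by rewrite -[leRHS]n1 nz norm_pair /= le_max lexx orbT.
    by rewrite ler_norml => /andP[].
  rewrite -pth// /Th (_ : z.2 + 2^-1 = 0); last by lra.
  by rewrite subr0 mul1r mul0r addr0.
rewrite leNgt zs /= -pth// => -[e|e|e].
- by rewrite e ltxx in zs.
- rewrite /Th thb; last exact: to_cube_boundary.
  by rewrite -mulrDl subrK mul1r.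
- rewrite /Th (_ : z.2 + 2^-1 = 1); last by lra.
  by rewrite subrr mul0r add0r mul1r.
Qed.

Let cTh : continuous Th.
Proof.
have cz : continuous (fun z : Z => z.2 + 2^-1).
  by move=> z; apply: ctsD; [exact: cvg_snd|exact: cts_cst].
move=> z; apply: ctsD; apply: ctsM; try exact: cts_cst; try exact: cz.
  by apply: ctsB; [exact: cts_cst|exact: cz].
apply: (@cts_comp _ _ _ (fun z : Z => to_cube (2 *: z.1)) th); last exact: cth.
apply: (@cts_comp _ _ _ (fun z : Z => 2 *: z.1)); last exact: to_cube_continuous.
by apply: cts_scale; [exact: cts_cst|exact: cvg_fst].
Qed.

Let cPhi : {within [set z : Z | `|z| <= 1], continuous Phi}.
Proof.
have cn : continuous (fun z : Z => `|z|) by move=> z; exact: norm_cts.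
have cl1 : closed [set z : Z | `|z| <= 2^-1].
  apply: (@preimage_closed _ _ (fun z : Z => `|z|) [set t : R | t <= 2^-1]).
    by move=> z _; exact: norm_cts.
  exact: closed_le.
have cl2 : closed [set z : Z | 2^-1 <= `|z|].
  apply: (@preimage_closed _ _ (fun z : Z => `|z|) [set t : R | 2^-1 <= t]).
    by move=> z _; exact: norm_cts.
  exact: closed_ge.
apply: (@continuous_subspaceW _ _ _
  ([set z : Z | `|z| <= 2^-1] `|` [set z : Z | 2^-1 <= `|z|])).
  by move=> z _; apply/orP; exact: le_total.
apply: within_paste => //.
- by apply: continuous_subspaceT => z; apply: cts_comp; [exact: cTh|exact: cp].
- apply: (@within_comp _ _ _ _ _ (fun z : Z => (phi (nu z), 2 - 2 * `|z|)) h _ _ ch).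
    apply: within_pair.
      apply: (within_comp (continuous_subspaceT cnu) _ cphi).
      by move=> z /= /nu_norm.
    apply: continuous_subspaceT => z; apply: ctsB; first exact: cts_cst.
    by apply: ctsM; [exact: cts_cst|exact: norm_cts].
  by move=> z _; split=> //=; exact: phiS.
- by move=> z /= ->.
- by move=> z /= h1 h2 _; apply: Phi_outer_inner; apply/eqP; rewrite eq_le h1 h2.
- by move=> z /= _; rewrite -ltNge => /ltW.
Qed.

(** A homotopy, relative to the boundary, from F to a constant map. In
    coordinates where the box is the unit ball, the outer shell, of norm between
    1/2 and 1, is filled by the deformation h applied to the values phi on the
    sphere, and the inner ball by the image under p of the linear contraction of
    the lift th of F deformed by h. The shell absorbs the path along which h
    moves the base point. *)
Lemma ball_filling : exists Psi : Z -> T,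
  [/\ {within [set z | cube z.1 /\ 0 <= z.2 <= 1], continuous Psi},
    forall z, S (Psi z), forall u, cube u -> Psi (u, 0) = F u,
    forall u, cube u -> Psi (u, 1) = F 0 &
    forall u t, cube_boundary u -> 0 <= t <= 1 -> Psi (u, t) = F 0].
Proof.
pose ball_of (z : Z) : Z := (of_cube z.1, 2 * z.2 - 1).
have cball : continuous ball_of.
  move=> z; apply: cts_pair.
    by apply: cts_comp; [exact: cvg_fst|exact: of_cube_continuous].
  apply: ctsB; last exact: cts_cst.
  by apply: ctsM; [exact: cts_cst|exact: cvg_snd].
have ball_norm (z : Z) : cube z.1 -> 0 <= z.2 <= 1 -> `|ball_of z| <= 1.
  move=> cz /andP[z0 z1]; rewrite norm_pair ge_max of_cube_norm//= ler_norml.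
  by apply/andP; split; lra.
have sphere (z : Z) : `|ball_of z| = 1 -> Phi (ball_of z) = phi (ball_of z).
  move=> z1; rewrite /Phi z1 ifF; last first.
    by apply/negbTE; rewrite -ltNge invf_lt1 ?ltr1n.
  rewrite mulr1 subrr h0 ?phiS//; congr phi.
  rewrite /nu z1 max_r ?invf_le1 ?ler1n// invr1 scale1r mul1r.
  by case: (ball_of z).
have edge (z : Z) : cube z.1 -> 0 <= z.2 <= 1 ->
    [\/ z.2 = 0, z.2 = 1 | cube_boundary z.1] -> `|ball_of z| = 1.
  move=> cz z01 e; apply/eqP; rewrite eq_le ball_norm//= norm_pair le_max /=.
  case: e => [->|->|/of_cube_norm1 ->]; last by rewrite lexx.
    by rewrite mulr0 sub0r normrN normr1 lexx orbT.
  by rewrite mulr1 ger0_norm; [apply/orP; right|]; lra.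
exists (Phi \o ball_of); split.
- apply: (within_comp (continuous_subspaceT cball) _ cPhi).
  by move=> z [cz z01]; exact: ball_norm.
- by move=> z /=; rewrite /Phi; case: ifP => _; [exact: pS|exact/hS/phiS].
- move=> u cu /=; rewrite sphere; last first.
    by apply: edge => //=; [rewrite lexx ler01|constructor 1].
  by rewrite /phi /= mulr0 sub0r lexx of_cubeK.
- move=> u cu /=; rewrite sphere; last first.
    by apply: edge => //=; [rewrite lexx ler01|constructor 2].
  by rewrite /phi /= ifF//; apply/negbTE; rewrite -ltNge; lra.
- move=> u t ub t01 /=; have cu : cube u by case: ub.
  rewrite sphere; last by apply: edge => //=; constructor 3.
  by rewrite /phi /= of_cubeK; case: ifP => // _; exact: Fb.
Qed.

End Filling.

(** * Asphericity *)

Section Asphericity.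
Variables (R : realType) (V : finType) (K C : {set {set V}}).

Local Notation W := ({ptws V -> R}).
Local Notation poly K := (@polyhedron V R K).

Hypotheses (hK : simplicial_complex K) (KC : deforms_into R C K).

(** The polyhedron is taken as a closed subset of a space of row vectors, which is
    metric and hence normal, as is its product with the line. *)
Lemma deformation_homotopy : exists h : W * R -> W,
  [/\ {within poly K `*` setT, continuous h},
    forall x t, poly K x -> poly K (h (x, t)),
    forall x, poly K x -> h (x, 0) = x &
    forall x, poly K x -> poly C (h (x, 1))].
Proof.
pose f (u : 'rV[R]_#|V|) : W := fun v => u ord0 (enum_rank v).
pose row (x : W) : 'rV[R]_#|V| := \row_i x (enum_val i).
have rowK x : f (row x) = x.
  by apply/funext => v; rewrite /f mxE enum_rankK.
have cf : continuous f.
  by apply/continuous_ptwsP => v u; exact: coord_continuous.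
have crow : continuous row.
  move=> x; apply: cts_row => i.
  have -> : (fun y => row y ord0 i) = fun y : W => y (enum_val i).
    by apply/funext => y; rewrite mxE.
  exact: coord_ptws_continuous.
pose D0 := [set u | forall v, 0 <= f u v] `&` [set u | \sum_v f u v = 1].
have cD0 : closed D0.
  apply: closedI.
    rewrite (_ : mkset _ = \bigcap_(v in setT) [set u | 0 <= f u v]).
      apply: closed_bigI => v _.
      apply: (@preimage_closed _ _ (fun u => f u v) [set t : R | 0 <= t]).
        by move=> u _; exact: coord_continuous.
      exact: closed_ge.
    by rewrite eqEsubset; split=> u uv => [v _|v]; apply: uv.
  apply: (@preimage_closed _ _ (fun u => \sum_v f u v) [set t : R | t = 1]).
    by move=> u _; apply: cts_sum => v _; exact: coord_continuous.
  exact: closed_eq.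
have f0 u : D0 u -> poly [set: {set V}]%SET (f u).
  by move=> [u0 u1]; split=> //; rewrite finset.inE.
have cD := polyhedron_closed hK cD0 (continuous_subspaceT cf) f0.
have Df u : (D0 `&` [set u | poly K (f u)]) u -> poly K (f u) by case.
have Drow x : poly K x -> (D0 `&` [set u | poly K (f u)]) (row x).
  move=> xK; split; rewrite /= ?rowK//.
  by case: xK => x0 x1 _; split; rewrite /= rowK.
have [h [ch hK' h0 h1]] := KC (@pseudometric_normal R _) (@pseudometric_normal R _)
  cD (continuous_subspaceT cf) Df.
exists (fun y => h (row y.1, y.2)); split.
- apply: (@within_comp _ _ _ _ _ (fun y : W * R => (row y.1, y.2)) h _ _ ch).
    apply: continuous_subspaceT => y; apply: cts_pair; last exact: cvg_snd.
    by apply: cts_comp; [exact: cvg_fst|exact: crow].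
  by move=> [x t] [/= xK _]; split=> //; exact: Drow.
- by move=> x t xK; apply: hK'; exact: Drow.
- by move=> x xK; rewrite h0 ?rowK//; exact: Drow.
- by move=> x xK; apply: h1; exact: Drow.
Qed.

End Asphericity.

Section AsphericalRealization.
Variables (R : realType) (V : finType) (K : {set {set V}}) (sigma : {set V}).

Local Notation W := ({ptws V -> R}).
Local Notation poly K := (@polyhedron V R K).
Local Notation bd := (simplex sigma :\ sigma)%SET.

Hypotheses (hK : simplicial_complex K) (card_sigma : #|sigma| = 3%N)
  (bdK : bd \subset K) (KC : deforms_into R bd K).

Let point_of (x0 : realization R K) (x : W) : realization R K := insubd x0 x.

Let point_ofE x0 x : poly K x -> set_val (point_of x0 x) = x.
Proof.
by move=> xK; rewrite set_valE val_insubd ifT//; exact/mem_set.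
Qed.

Let valP (x : realization R K) : poly K (set_val x).
Proof. exact: set_valP. Qed.

Let val_inj' (x y : realization R K) : set_val x = set_val y -> x = y.
Proof. by rewrite set_valE => /val_inj. Qed.

Lemma trivial_pi_of_deformation n (x0 : realization R K) :
  (2 <= n)%N -> trivial_pi R n x0.
Proof.
move=> n2 f [cf fb].
have [h [ch hS h0 h1]] := deformation_homotopy hK KC.
have [p [cp pbd _ plift]] := @boundary_cover R V sigma card_sigma.
have n0 : (0 < n)%N by exact: ltnW.
have cube0 : cube_boundary (0 : 'rV[R]_n).
  split; first by move=> i; rewrite mxE lexx ler01.
  by exists (Ordinal n0); left; rewrite mxE.
pose F u : W := set_val (f (clamp u)).
have cF : continuous F.
  apply/continuous_subspace_setT.
  apply: (@within_comp _ _ _ setT (@cube R n) (@clamp R n)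
    (fun u => set_val (f u) : W)).
  - by apply: continuous_subspaceT; exact: clamp_continuous.
  - by move=> u _; exact: clamp_cube.
  - by move/within_set_val : cf.
have FK u : poly K (F u) by exact: valP.
have FE u : cube u -> F u = set_val (f u) by move=> cu; rewrite /F clamp_id.
have Fb u : cube_boundary u -> F u = set_val x0.
  by move=> ub; rewrite FE ?fb//; case: ub.
have F0 : F 0 = set_val x0 by exact: Fb.
have cG : continuous (fun u => h (F u, 1)).
  apply/continuous_subspace_setT.
  apply: (@within_comp _ _ _ setT (poly K `*` setT)
    (fun u => (F u, 1 : R)) h _ _ ch).
    apply: continuous_subspaceT => u.
    by apply: cts_pair; [exact: cF|exact: cts_cst].
  by move=> u _; split=> //=; exact: FK.
have [|th [cth pth thb]] := plift n _ cG; first by move=> u; apply: h1; exact: FK.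
have thb' u : cube_boundary u -> th u = th 0.
  by apply: thb => // v vb; rewrite Fb// F0.
have pS t : poly K (p t) by apply: (polyhedron_sub bdK); exact: pbd.
have Fb' u : cube_boundary u -> F u = F 0 by move=> ub; rewrite Fb// F0.
have [Psi [cPsi PsiS Psi0 Psi1 Psib]] :=
  ball_filling n0 ch hS h0 cp pS cF FK Fb' cth pth thb'.
exists (fun z => point_of x0 (Psi z)); split.
- apply/within_set_val; apply: within_eq cPsi => z _.
  by rewrite point_ofE.
- by move=> u cu; apply: val_inj'; rewrite point_ofE// Psi0// FE.
- by move=> u cu; apply: val_inj'; rewrite point_ofE// Psi1// F0.
- by move=> u t ub t01; apply: val_inj'; rewrite point_ofE// Psib// F0.
Qed.

(** Every point is moved to the boundary of the triangle, where the covering p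
    leads it to p 0. *)
Lemma path_connected_of_deformation : path_connected R (realization R K).
Proof.
have [h [ch hS h0 h1]] := deformation_homotopy hK KC.
have [p [cp pbd psurj _]] := @boundary_cover R V sigma card_sigma.
have pS t : poly K (p t) by apply: (polyhedron_sub bdK); exact: pbd.
split; first by exists (exist _ (p 0) (mem_set (pS 0))).
have walk (x : W) : poly K x -> exists g : R -> W,
    [/\ continuous g, forall t, poly K (g t), g 0 = x & g 2 = p 0].
  move=> xK; have [t pt] := psurj _ (h1 x xK).
  exists (fun s => if s <= 1 then h (x, s) else p (t * (2 - s))); split.
  - apply/continuous_subspace_setT.
    rewrite (_ : setT = [set s : R | s <= 1] `|` [set s | 1 <= s]); last first.
      by rewrite eqEsubset; split=> s //= _; exact/orP/le_total.
    apply: within_paste.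
    + exact: closed_le.
    + exact: closed_ge.
    + apply: (@within_comp _ _ _ _ (poly K `*` setT)
        (fun s : R => (x, s)) h) => //.
      apply: continuous_subspaceT => s.
      by apply: cts_pair; [exact: cvg_cst|exact: cvg_id].
    + apply: continuous_subspaceT => s; apply: cts_comp; last exact: cp.
      apply: ctsM; first exact: cts_cst.
      by apply: ctsB; [exact: cts_cst|exact: cvg_id].
    + by move=> s /= ->.
    + move=> s /= s1 s1' _; have -> : s = 1 by apply/eqP; rewrite eq_le s1 s1'.
      by rewrite -pt (_ : 2 - 1 = 1) ?mulr1//; lra.
    + by move=> s /= ->.
    + by move=> s.
  - by move=> s; case: ifP => _; [exact: hS|exact: pS].
  - by rewrite ler01 h0.
  - by rewrite ifF ?subrr ?mulr0//; apply/negbTE; rewrite -ltNge ltr1n.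
move=> x y.
have [gx [cgx gxK gx0 gx2]] := walk _ (valP x).
have [gy [cgy gyK gy0 gy2]] := walk _ (valP y).
pose g t := if t <= 2^-1 then gx (4 * t) else gy (4 * (1 - t)).
have gK t : poly K (g t) by rewrite /g; case: ifP.
exists (fun t => point_of x (g t)); split; last 2 first.
- by apply: val_inj'; rewrite point_ofE// /g invr_ge0 ler0n mulr0.
- apply: val_inj'; rewrite point_ofE// /g ifF ?subrr ?mulr0//.
  by apply/negbTE; rewrite -ltNge invf_lt1 ?ltr1n.
apply/within_set_val; apply: (@within_eq _ _ _ g) => [t _|].
  by rewrite point_ofE.
apply: (@continuous_subspaceW _ _ _
  ([set t : R | t <= 2^-1] `|` [set t | 2^-1 <= t])).
  by move=> t _; exact/orP/le_total.
apply: within_paste.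
- exact: closed_le.
- exact: closed_ge.
- apply: continuous_subspaceT => t; apply: cts_comp; last exact: cgx.
  by apply: ctsM; [exact: cts_cst|exact: cvg_id].
- apply: continuous_subspaceT => t; apply: cts_comp; last exact: cgy.
  apply: ctsM; first exact: cts_cst.
  by apply: ctsB; [exact: cts_cst|exact: cvg_id].
- by move=> t /= ->.
- move=> t /= h2 h2' _; have -> : t = 2^-1 by apply/eqP; rewrite eq_le h2 h2'.
  have -> : 4 * 2^-1 = 2 :> R by lra.
  have -> : 4 * (1 - 2^-1) = 2 :> R by lra.
  by rewrite gx2 gy2.
- by move=> t /= ->.
- by move=> t.
Qed.

End AsphericalRealization.

Local Close Scope ring_scope.
Local Close Scope classical_set_scope.

Theorem corollary3p6 (R : realType) (V : finType) (L : {set {set V}})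
    (sigma : {set V}) (hL : simplicial_complex L) (hdim : dimension L = 2)
    (hqc : contractible_quasi_constructible R L)
    (hsigma : sigma \in L) (hsigma2 : #|sigma| = 3) :
  aspherical R (realization R (L :\ sigma)%SET).
Proof.
have [n0 down] := hL.
have hK : simplicial_complex (L :\ sigma)%SET.
  split; first by rewrite finset.inE (negPf n0) andbF.
  move=> s t; rewrite !finset.inE => /andP[ss sL] ts t0.
  rewrite (down _ _ sL ts t0) andbT; apply: contraNneq ss => tE.
  by apply/eqP/(top_simplex_maximal hdim hsigma2 sL); rewrite -tE.
have bdK : (simplex sigma :\ sigma \subset L :\ sigma)%SET.
  apply: finset.setSD; apply/fintype.subsetP => t; rewrite finset.inE.
  by move=> /andP[t0 ts]; exact: down hsigma ts t0.
have KC := deforms_into_boundary hL hdim hsigma hsigma2 hqc.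
split; first exact: path_connected_of_deformation hsigma2 bdK KC.
by move=> n x0 n2; exact: trivial_pi_of_deformation hsigma2 bdK KC n x0 n2.
Qed.
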